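(* A. Let $u\in W$, let $u=s_{j_l}\cdots s_{j_1}$ be a reduced decomposition, $\alpha^k=s_{j_1}\cdots s_{j_{k-1}}(\alpha_{j_k})$, $s^k=s_{\alpha^k}$ for $1\le k\le l$, and let $1\le r\le p\le l$. Then for any $p\ge i\ge r$, $w\in W$ and $\nu\in\nu_R$, $$\mathrm{ord}_w^\nu\bigl(\kappa^\delta(g_{\alpha^i}\,f_{s^i(\alpha^{i-1})}\cdots f_{s^i(\alpha^r)})\bigr)\ \ge\ \mathrm{ord}_w^\nu\bigl(\kappa^\delta(f_{\alpha^i}\cdots f_{\alpha^r})\bigr).$$ B. Let $b=\pi_rs_{j_l}\cdots s_{j_1}$ be a reduced decomposition of $b\in P_+$ in $\hat W$, $\tilde\alpha^k=s_{j_1}\cdots s_{j_{k-1}}(\alpha_{j_k})$, and $\sigma^k=s_{\tilde\alpha^k}$ for $1\le k\le l$. Then for any $1\le i\le l$, $w\in W$ and $\nu\in\nu_R$, $$\mathrm{ord}_w^\nu\bigl(\kappa^\delta(g_{\tilde\alpha^i}\,f_{\sigma^i(\tilde\alpha^{i-1})}\cdots f_{\sigma^i(\tilde\alpha^1)}\,\sigma^i)\bigr)\ \ge\ \mathrm{ord}_w^\nu\bigl(\kappa^\delta(f_{\tilde\alpha^i}\cdots f_{\tilde\alpha^1})\bigr).$$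
   Context: **Root data.** $R\subset\mathbb R^n$ is an irreducible reduced root system with simple roots $\alpha_1,\dots,\alpha_n$, positive roots $R_+$, Weyl group $W$, simple reflections $s_i$; the form is normalized by $(\alpha,\alpha)=2$ for short roots (all roots are short in the simply-laced case). $\nu_\alpha=(\alpha,\alpha)/2$, $\nu_R=\{\nu_\alpha\}$, $\alpha^\vee=2\alpha/(\alpha,\alpha)$; $P$ is the weight lattice, $P_+$ the dominant weights; $\rho_\nu^\vee=\frac1{2\nu}\sum_{\alpha\in R_+,\nu_\alpha=\nu}\alpha$. $\vartheta$ is the maximal short root. Affine roots $\tilde\alpha=[\alpha,\nu_\alpha j]\in\mathbb R^n\times\mathbb R$ ($\alpha\in R$, $j\in\mathbb Z$), $\alpha_0=[-\vartheta,1]$, $s_{\tilde\alpha}([z,\zeta])=[z,\zeta]-(z,\alpha^\vee)\tilde\alpha$, $b\in P$ acts by $b([z,\zeta])=[z,\zeta-(z,b)]$. $\hat W=W\ltimes P=\Pi\ltimes\langle s_0,\dots,s_n\rangle$, $\Pi=\{\pi_r\}$ the stabilizer of $\{\alpha_0,\dots,\alpha_n\}$; $l(\pi_r\tilde w)=l(\tilde w)$. **Operators.** Let $q$ and $t_\nu$ ($\nu\in\nu_R$) be independent parameters, $t_\alpha=t_{\nu_\alpha}$, and write $q^{(\rho_k,b)}:=\prod_\nu t_\nu^{(\rho_\nu^\vee,b)}$. Difference-reflection operators are finite sums of $g\,\Gamma_a\,v$ with $g$ a rational function of the $X_b$ ($b\in P$, $X_bX_c=X_{b+c}$) over the field of rational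 functions of fractional powers of $q$ and of $t_\nu^{1/2}$, $a\in P$, $v\in W$; $\Gamma_bX_a=q^{(a,b)}X_a\Gamma_b$, $vX_a=X_{v(a)}v$, $v\Gamma_b=\Gamma_{v(b)}v$. An element $b\in P\subset\hat W$ is identified with $\Gamma_{-b}$, so $s_{[\alpha,\nu_\alpha j]}=\Gamma_{j\alpha}s_\alpha$; $X_{[\alpha,\nu_\alpha j]}=q^{\nu_\alpha j}X_\alpha$. For an affine root $\tilde\alpha=[\alpha,\nu_\alpha j]$: $f_{\tilde\alpha}=\dfrac{t_\alpha X_{\tilde\alpha}^{-1}-1}{X_{\tilde\alpha}^{-1}-1}$, $g_{\tilde\alpha}=\dfrac{t_\alpha-1}{1-X_{\tilde\alpha}^{-1}}$. **The map $\kappa^\delta$ and orders.** Let $\zeta_w$ ($w\in W$) be the orthogonal idempotents in functions on $W$, and let $v\in W$ act by $\delta(v)\zeta_w=\zeta_{vw}$. $\kappa^\delta$ is the algebra homomorphism from difference-reflection operators to operators on $W$-spinors (functions on $W$ with values in functions of $X$) with $\kappa^\delta(X_b)=\sum_wq^{-(\rho_k,w^{-1}(b))}X_{w^{-1}(b)}\zeta_w$, $\kappa^\delta(\Gamma_b)=\sum_wq^{-(\rho_k,w^{-1}(b))}\Gamma_{w^{-1}(b)}\zeta_w$, $\kappa^\delta(v)=\delta(v)$. For an operator $g\Gamma_a$, $\mathrm{ord}_w^\nu(\kappa^\delta(g\Gamma_a))$ is the order in $t_\nu$ (order of zero, or minus order of pole, at $t_\nu=0$) of the coefficient of $\Gamma_{w^{-1}(a)}\zeta_w$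 in $\kappa^\delta(g\Gamma_a)$; for $v\in W$, $\mathrm{ord}_w^\nu(\kappa^\delta(g\Gamma_av)):=\mathrm{ord}_w^\nu(\kappa^\delta(g\Gamma_a))$. *)

(* Defs.v *)
From HB Require Import structures.
From mathcomp Require Import all_boot all_order all_algebra.
From mathcomp Require Import generic_quotient.
From mathcomp Require Import reals freeg mpoly.

Set Implicit Arguments.
Unset Strict Implicit.
Unset Printing Implicit Defensive.

Import Order.TTheory GRing.Theory Num.Theory.
Local Open Scope ring_scope.

Section Euclidean.
Context {R : realType} {n : nat}.
Implicit Types a x y : 'cV[R]_n.

Definition dot x y : R := (x^T *m y) 0 0.

Definition coroot a : 'cV[R]_n := (2 / dot a a) *: a.

Definition nu a : R := dot a a / 2.

(* refl a *m x = x - (x, a^vee) a *)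
Definition refl a : 'M[R]_n := 1%:M - a *m (coroot a)^T.

(* The vectors simple i are the columns of simple_mx, so rcoef simple x is the
   column of the coordinates of x in the basis simple. *)
Definition simple_mx (simple : 'I_n -> 'cV[R]_n) : 'M[R]_n :=
  \matrix_(i, j) simple j i 0.

Definition rcoef (simple : 'I_n -> 'cV[R]_n) x : 'cV[R]_n :=
  invmx (simple_mx simple) *m x.

End Euclidean.

(* Irreducible reduced root systems in R^n with a choice of simple roots; the
   invariant form is the standard one, with (a, a) = 2 for short roots. *)
Record rootData (R : realType) (n : nat) := RootData {
  roots : seq 'cV[R]_n;
  simple : 'I_n -> 'cV[R]_n;
  theta : 'cV[R]_n;
  roots_uniq : uniq roots;
  roots_neq0 : 0 \notin roots;
  roots_refl : {in roots &, forall a b, refl a *m b \in roots};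
  roots_int : {in roots &, forall a b, dot b (coroot a) \is a Num.int};
  roots_reduced :
    {in roots, forall a (c : R), c *: a \in roots -> c = 1 \/ c = -1};
  roots_irreducible : forall A : pred 'cV[R]_n,
    (exists2 a, a \in roots & A a) -> (exists2 b, b \in roots & ~~ A b) ->
    exists a b, [/\ a \in roots, b \in roots, A a, ~~ A b & dot a b != 0];
  short_exists : exists2 a, a \in roots & dot a a = 2;
  short_min : {in roots, forall a, 2 <= dot a a};
  simple_root : forall i, simple i \in roots;
  simple_basis : simple_mx simple \in unitmx;
  simple_sign : {in roots, forall a,
    (forall i, rcoef simple a i 0 \is a Num.nat) \/
    (forall i, rcoef simple (- a) i 0 \is a Num.nat)};
  theta_root : theta \in roots;
  theta_short : dot theta theta = 2;
  theta_max : {in roots, forall a, dot a a = 2 ->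
    forall i, rcoef simple (theta - a) i 0 \is a Num.nat}
}.

Section RootData.
Context {R : realType} {n : nat} (D : rootData R n).
Implicit Types (a b : 'cV[R]_n) (w : 'M[R]_n).

Definition posroots : seq 'cV[R]_n :=
  [seq a <- roots D | [forall i, 0 <= rcoef (simple D) a i 0]].

Definition nuR : seq R := undup [seq nu a | a <- roots D].

Definition inP b : bool :=
  all (fun a => dot b (coroot a) \is a Num.int) (roots D).

Definition inPplus b : bool :=
  inP b && [forall i, 0 <= dot b (coroot (simple D i))].

Definition fweight (i : 'I_n) : 'cV[R]_n :=
  col i (invmx (\matrix_(k, l) coroot (simple D k) l 0)).

Definition rhov (v : R) : 'cV[R]_n :=
  (2 * v)^-1 *: \sum_(a <- posroots | nu a == v) a.

(* Words are functions on positions 1, ..., l; other values do not matter. *)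
Definition wword (j : nat -> 'I_n) (l : nat) : 'M[R]_n :=
  \big[mulmx/1%:M]_(k <- rev (index_iota 1 l.+1)) refl (simple D (j k)).

Definition inW w : Prop := exists j l, w = wword j l.

Definition wreduced (j : nat -> 'I_n) (l : nat) : Prop :=
  forall j' l', wword j' l' = wword j l -> (l <= l')%N.

Definition wroot (j : nat -> 'I_n) (k : nat) : 'cV[R]_n :=
  (\big[mulmx/1%:M]_(1 <= i < k) refl (simple D (j i))) *m simple D (j k).

Definition affv : Type := ('cV[R]_n * R)%type.

Implicit Types (e z : affv) (f g : affv -> affv).

Definition acomp f g : affv -> affv := f \o g.

Definition arefl e z : affv :=
  (z.1 - dot z.1 (coroot e.1) *: e.1, z.2 - dot z.1 (coroot e.1) * e.2).

Definition atrans b z : affv := (z.1, z.2 - dot z.1 b).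

Definition asimple (i : 'I_n.+1) : affv :=
  if unlift ord0 i is Some i' then (simple D i', 0) else (- theta D, 1).

(* Elements of the extended affine Weyl group are given by their action on
   R^n x R, which is faithful. *)
Definition inWhat g : Prop := exists b w,
  [/\ inP b, inW w & g =1 (fun z => atrans b (w *m z.1, z.2))].

Definition inPi g : Prop :=
  inWhat g /\ forall i, exists i', g (asimple i) = asimple i'.

Definition aword (j : nat -> 'I_n.+1) (l : nat) : affv -> affv :=
  \big[acomp/id]_(k <- rev (index_iota 1 l.+1)) arefl (asimple (j k)).

(* Since l(pi_r w) = l(w), a decomposition pi_r s_{j_l} ... s_{j_1} is reduced
   if and only if s_{j_l} ... s_{j_1} is. *)
Definition areduced (j : nat -> 'I_n.+1) (l : nat) : Prop :=
  forall j' l', aword j' l' =1 aword j l -> (l <= l')%N.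

Definition aroot (j : nat -> 'I_n.+1) (k : nat) : affv :=
  (\big[acomp/id]_(1 <= i < k) arefl (asimple (j i))) (asimple (j k)).

End RootData.

(* Orders of rational functions; None stands for the order +oo of 0. *)
Definition omin (x y : option rat) : option rat :=
  match x, y with
  | Some a, Some b => Some (Num.min a b)
  | Some a, None => Some a
  | None, _ => y
  end.

Definition ole (x y : option rat) : bool :=
  match x, y with
  | _, None => true
  | None, Some _ => false
  | Some a, Some b => a <= b
  end.

(* The integer m is such that (P, P) is contained in (1/m) Z, so that only
   integral powers of q^{1/m} occur. *)
Section Operators.
Context (F : fieldType) {R : realType} {n : nat} (D : rootData R n) (m : nat).
Implicit Types (a b : 'cV[R]_n) (v w : 'M[R]_n).

(* The variables are X_{omega_i} (i < n), q^{1/m} and t_v^{1/2} (v in nuR). *)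
Definition nvars : nat := n + (size (nuR D)).+1.

Definition polys : Type := {mpoly F[nvars]}.
Definition ratfun : Type := {fraction {mpoly F[nvars]}}.
HB.instance Definition _ := GRing.Field.on ratfun.

Definition Xidx (i : 'I_n) : 'I_nvars := lshift _ i.
Definition qidx : 'I_nvars := rshift n ord0.
Definition tidx (v : R) : 'I_nvars := rshift n (inord (index v (nuR D)).+1).

Definition gen (i : 'I_nvars) : ratfun := FracField.tofrac 'X_i.

Definition qpow (x : R) : ratfun := gen qidx ^ Num.floor (m%:R * x).

Definition tpar (v : R) : ratfun := gen (tidx v) ^+ 2.

Definition X b : ratfun :=
  \prod_(i < n) gen (Xidx i) ^ Num.floor (dot b (coroot (simple D i))).

(* q^{(rho_k, b)} = prod_v t_v^{(rhov v, b)}, where 2 (rhov v, b) is an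
   integer for b in P *)
Definition qrho b : ratfun :=
  \prod_(v <- nuR D) gen (tidx v) ^ Num.floor (2 * dot (rhov D v) b).

(* the substitution X_{omega_i} := y i in a rational function *)
Definition substX (y : 'I_n -> ratfun) (g : ratfun) : ratfun :=
  let ev := mmap (fun c : F => FracField.tofrac c%:MP : ratfun)
    (fun i => match split i with inl i' => y i' | inr _ => gen i end) in
  ev (frac (repr g)).1 / ev (frac (repr g)).2.

(* Gamma_a X_b = q^{(a, b)} X_b Gamma_a and v X_b = X_{v(b)} v *)
Definition actG a : ratfun -> ratfun :=
  substX (fun i => qpow (dot a (fweight D i)) * X (fweight D i)).
Definition actW v : ratfun -> ratfun :=
  substX (fun i => X (v *m fweight D i)).

(* The formal sum of the << g *g (a, v) >> is the sum of the g Gamma_a v. Only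
   a in P and v in W are meant; the types allow all vectors and matrices. *)
Definition dro : Type := {freeg ('cV[R]_n * 'M[R]_n) / ratfun}.
HB.instance Definition _ := GRing.Zmodule.on dro.

Definition dterm (g : ratfun) a v : dro := << g *g (a, v) >>.

(* (g Gamma_a v) (h Gamma_b u) = g Gamma_a(v(h)) Gamma_{a + v(b)} v u *)
Definition dmul (S T : dro) : dro :=
  \sum_(x <- dom S) \sum_(y <- dom T)
    dterm (coeff x S * actG x.1 (actW x.2 (coeff y T)))
          (x.1 + x.2 *m y.1) (x.2 *m y.2).

Definition dfun (g : ratfun) : dro := dterm g 0 1%:M.

Definition done1 : dro := dfun 1.

(* An operator on W-spinors sum_w sum c Gamma_b zeta_w delta(v) is given by
   the formal sums T w of the << c *g (b, v) >>. *)
Definition spinop : Type := 'M[R]_n -> dro.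

(* the coefficient of zeta_w in kappa(g), for a rational function g *)
Definition kappaX w : ratfun -> ratfun :=
  substX (fun i => (qrho (invmx w *m fweight D i))^-1
                   * X (invmx w *m fweight D i)).

(* kappa(g Gamma_a v) = kappa(g) kappa(Gamma_a) delta(v) *)
Definition kappa (S : dro) : spinop := fun w =>
  \sum_(x <- dom S)
    dterm (kappaX w (coeff x S) * (qrho (invmx w *m x.1))^-1)
          (invmx w *m x.1) x.2.

Definition pord (i : 'I_nvars) (p : polys) : nat :=
  \big[minn/msize p]_(mm <- msupp p) (mm : 'X_{1..nvars}) i.

(* The variable of index tidx v is t_v^{1/2}, hence the division by 2. *)
Definition tord (v : R) (g : ratfun) : option rat :=
  if g == 0 then None
  else Some (((pord (tidx v) (frac (repr g)).1)%:R
              - (pord (tidx v) (frac (repr g)).2)%:R) / 2).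

(* On kappa(g Gamma_a v), whose only term at zeta_w is a multiple of
   Gamma_{w^{-1}(a)} delta(v), this is the order of the coefficient; see
   sord_kappa below. *)
Definition sord (v : R) w (T : spinop) : option rat :=
  \big[omin/None]_(x <- dom (T w)) tord v (coeff x (T w)).

(* the indices [a, nu_a j] of X, f, g, and the operators s_{[a, nu_a j]} *)
Definition Xaff (e : affv) : ratfun := qpow e.2 * X e.1.

Definition faff (e : affv) : ratfun :=
  (tpar (nu e.1) * (Xaff e)^-1 - 1) / ((Xaff e)^-1 - 1).

Definition gaff (e : affv) : ratfun :=
  (tpar (nu e.1) - 1) / (1 - (Xaff e)^-1).

Definition saff (e : affv) : dro :=
  dterm 1 ((e.2 / nu e.1) *: e.1) (refl e.1).

Lemma substX0 (y : 'I_n -> ratfun) : substX y 0 = 0.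
Proof.
rewrite /substX; suff -> : (frac (repr (0 : ratfun))).1 = 0.
  by rewrite /mmap msupp0 big_nil mul0r.
apply/eqP; rewrite FracField.numer0 reprK; apply/eqP.
rewrite -(tofrac0 {mpoly F[nvars]}); unlock FracField.tofrac.
by congr (\pi_(_)%qT _); apply: val_inj; rewrite /= /Ratio val_insubd /= oner_neq0.
Qed.

Lemma kappa_term g a v w :
  kappa (dterm g a v) w =
  dterm (kappaX w g * (qrho (invmx w *m a))^-1) (invmx w *m a) v.
Proof.
rewrite /kappa /dterm; have [->|g0] := eqVneq g 0.
  by rewrite freegU0 dom0 big_nil /kappaX substX0 mul0r freegU0.
by rewrite domU // big_seq1 coeffU eqxx mulr1.
Qed.

Lemma sord_kappa (x : R) g a v w :
  sord x w (kappa (dterm g a v)) =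
  tord x (coeff (invmx w *m a, 1%:M) (kappa (dterm g a 1%:M) w)).
Proof.
rewrite /sord !kappa_term /dterm coeffU eqxx mulr1.
set c := kappaX w g * _; have [->|c0] := eqVneq c 0.
  by rewrite freegU0 dom0 big_nil /tord eqxx.
by rewrite domU // big_cons big_nil coeffU eqxx mulr1; case: tord.
Qed.

End Operators.

(* Main.v *)
From HB Require Import structures.
From mathcomp Require Import all_boot all_order all_algebra.
From mathcomp Require Import reals freeg mpoly ring lra zify.
From mathcomp Require Import generic_quotient.
Require Import Defs.

Set Implicit Arguments.
Unset Strict Implicit.
Unset Printing Implicit Defensive.

Import Order.TTheory GRing.Theory Num.Theory.
Local Open Scope ring_scope.

(** Let alpha = [alpha, nu_alpha j] be the i-th root of the word (j = 0 in the
    first part), beta = w^-1(alpha), and e = (rho_nu^vee, beta).  The order in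
    t_nu is additive, and kappa^delta sends X_alpha^-1 to a power of q times
    q^(rho_k, beta) X_beta^-1.  Since e >= 1 if beta > 0 has length nu, and
    e <= -1 if beta < 0 has length nu, the factor f_alpha has order 1 if
    nu_alpha = nu and beta < 0, and order 0 otherwise; g_alpha has order
    max(0, -e); and Gamma_(j alpha) contributes -j e.  Both parts thus amount to

      N <= max(0, -e) - j e + M,

    where N counts the k <= i with nu_k = nu and w^-1(alpha^k) < 0, and M the
    k < i with nu_k = nu and w^-1(s_alpha(alpha^k)) < 0.

    Counting with signs gives a closed formula for such numbers.  For an element
    g of the affine Weyl group and a root a, the number of positive affine
    roots over a that g makes negative, minus the number of negative ones that
    it makes positive, is an expression in g and a which is odd in a.  Hence the
    sum of the signs of w^-1(a), over the roots [a, nu_a k] with nu_a = nu of a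
    word with value g, is the sum of these expressions over the a = w(eta) with
    eta > 0 and nu_eta = nu (sum_sign_aroot), and this sum determines how many of
    the w^-1(a) are negative.  The values g and g' of the words of length i - 1
    and i satisfy g' = g s_alpha, where s_alpha is the affine reflection.  In the
    difference of the formulas for (g', w) and for (g, s_alpha w), all that
    depends on g cancels, the translation part of s_alpha accounts for the term
    - j e, and the claim becomes (aroot_count)

      [nu_beta = nu] <= max(0, -2 e) + l_nu(w s_beta) - l_nu(w),

    where l_nu counts the positive roots of length nu made negative.  This holds
    whenever w(beta) > 0 (flips_ge for beta > 0, flips_le for beta < 0).

    It remains to see that w(beta), the finite part of the i-th root, is
    positive.  For a finite word this is the exchange condition (reduced_pos).
    In the second part, the i-th root is positive and b makes it negative, by
    the exchange condition applied to two pieces of the word; as b is dominant,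
    its finite part must be positive (aroot_pos). *)

(** * Euclidean reflections *)

Section Dot.
Context {R : realType} {n : nat}.
Implicit Types (a b x y : 'cV[R]_n) (M w : 'M[R]_n).

Lemma dotE x y : dot x y = \sum_i x i 0 * y i 0.
Proof. by rewrite /dot mxE; apply: eq_bigr => i _; rewrite mxE. Qed.

Lemma dotC x y : dot x y = dot y x.
Proof. by rewrite !dotE; apply: eq_bigr => i _; rewrite mulrC. Qed.

Lemma dotDl x y b : dot (x + y) b = dot x b + dot y b.
Proof. by rewrite /dot linearD /= mulmxDl mxE. Qed.

Lemma dotZl c x b : dot (c *: x) b = c * dot x b.
Proof. by rewrite /dot linearZ /= -scalemxAl mxE. Qed.

Lemma dotNl x b : dot (- x) b = - dot x b.
Proof. by rewrite -scaleN1r dotZl mulN1r. Qed.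

Lemma dotBl x y b : dot (x - y) b = dot x b - dot y b.
Proof. by rewrite dotDl dotNl. Qed.

Lemma dot0l b : dot 0 b = 0.
Proof. by rewrite -(scale0r 0) dotZl mul0r. Qed.

Lemma dotDr x y b : dot b (x + y) = dot b x + dot b y.
Proof. by rewrite !(dotC b) dotDl. Qed.

Lemma dotZr c x b : dot b (c *: x) = c * dot b x.
Proof. by rewrite !(dotC b) dotZl. Qed.

Lemma dotNr x b : dot b (- x) = - dot b x.
Proof. by rewrite !(dotC b) dotNl. Qed.

Lemma dotBr x y b : dot b (x - y) = dot b x - dot b y.
Proof. by rewrite !(dotC b) dotBl. Qed.

Lemma dot0r b : dot b 0 = 0.
Proof. by rewrite dotC dot0l. Qed.

Lemma dot_suml (I : Type) (r : seq I) (P : pred I) (F : I -> 'cV[R]_n) b :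
  dot (\sum_(i <- r | P i) F i) b = \sum_(i <- r | P i) dot (F i) b.
Proof.
elim/big_rec2: _ => [|i y1 y2 _ <-]; first exact: dot0l.
by rewrite dotDl.
Qed.

Lemma dot_sumr (I : Type) (r : seq I) (P : pred I) (F : I -> 'cV[R]_n) b :
  dot b (\sum_(i <- r | P i) F i) = \sum_(i <- r | P i) dot b (F i).
Proof. by rewrite dotC dot_suml; apply: eq_bigr => i _; rewrite dotC. Qed.

Lemma dot_gt0 x : x != 0 -> 0 < dot x x.
Proof.
move=> x0; rewrite dotE lt_def; apply/andP; split; last first.
  by apply: sumr_ge0 => i _; rewrite -expr2 sqr_ge0.
apply: contra x0; rewrite psumr_eq0 => [/allP x0|i _]; last first.
  by rewrite -expr2 sqr_ge0.
apply/eqP/matrixP => i j; rewrite ord1 mxE; apply/eqP.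
by have := x0 i (mem_index_enum i); rewrite /= mulf_eq0 orbb.
Qed.

Lemma dot_mulmx M x y : dot (M *m x) y = dot x (M^T *m y).
Proof. by rewrite /dot trmx_mul mulmxA. Qed.

Lemma refl_mul a x : refl a *m x = x - dot x (coroot a) *: a.
Proof.
rewrite /refl mulmxBl mul1mx -mulmxA; congr (_ - _).
rewrite [(coroot a)^T *m x](mx11_scalar _) -/(dot _ _).
by rewrite mul_mx_scalar dotC.
Qed.

Lemma dot_coroot x a : dot x (coroot a) = dot x a / nu a.
Proof. by rewrite /coroot dotZr /nu invf_div mulrC mulrA. Qed.

Lemma refl_tr a : (refl a)^T = refl a.
Proof.
rewrite /refl linearB /= trmx1 trmx_mul trmxK /coroot; congr (_ - _).
by rewrite -scalemxAl linearZ /= scalemxAr.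
Qed.

Lemma refl_refl a x : a != 0 -> refl a *m (refl a *m x) = x.
Proof.
move=> a0; have d0 : dot a a != 0 by rewrite gt_eqF ?dot_gt0.
have d2 : dot a (coroot a) = 2 by rewrite dot_coroot /nu; field.
rewrite !refl_mul dotBl dotZl d2; set c := dot x _.
by rewrite -addrA -opprD -scalerDl (_ : c + (c - c * 2) = 0 :> R)
           ?scale0r ?subr0 //; ring.
Qed.

Lemma refl_id a : a != 0 -> refl a *m a = - a.
Proof.
move=> a0; have d0 : dot a a != 0 by rewrite gt_eqF ?dot_gt0.
have d2 : dot a (coroot a) = 2 by rewrite dot_coroot /nu; field.
by rewrite refl_mul d2 scaler_nat mulr2n opprD addrA subrr sub0r.
Qed.

Lemma refl_opp a : refl (- a) = refl a.
Proof.
rewrite /refl /coroot dotNl dotNr opprK; congr (_ - _).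
by rewrite scalerN linearN /= mulNmx mulmxN opprK.
Qed.

Lemma mulmx_inj w w' : (forall x, w *m x = w' *m x) -> w = w'.
Proof.
move=> e; apply/matrixP => i j; have := e (delta_mx j 0).
by rewrite -!colE => /colP /(_ i); rewrite !mxE.
Qed.

Section Isometry.
Variable w : 'M[R]_n.
Hypothesis wV : w^T *m w = 1%:M.

Lemma isomV : w *m w^T = 1%:M. Proof. exact: mulmx1C. Qed.

Lemma isomK x : w^T *m (w *m x) = x.
Proof. by rewrite mulmxA wV mul1mx. Qed.

Lemma isomKV x : w *m (w^T *m x) = x.
Proof. by rewrite mulmxA isomV mul1mx. Qed.

Lemma isom_inv : invmx w = w^T.
Proof.
have [_ u] := mulmx1_unit wV.
by rewrite -[LHS]mul1mx -wV -mulmxA mulmxV ?mulmx1.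
Qed.

Lemma dot_isom x y : dot (w *m x) (w *m y) = dot x y.
Proof. by rewrite dot_mulmx isomK. Qed.

Lemma nu_isom a : nu (w *m a) = nu a.
Proof. by rewrite /nu dot_isom. Qed.

Lemma coroot_isom a : coroot (w *m a) = w *m coroot a.
Proof. by rewrite /coroot dot_isom -scalemxAr. Qed.

Lemma refl_isom a x : refl (w *m a) *m (w *m x) = w *m (refl a *m x).
Proof. by rewrite !refl_mul coroot_isom dot_isom mulmxBr -scalemxAr. Qed.

End Isometry.

Lemma refl_isometry a : a != 0 -> (refl a)^T *m refl a = 1%:M.
Proof.
move=> a0; apply: mulmx_inj => x.
by rewrite refl_tr -mulmxA refl_refl // mul1mx.
Qed.

End Dot.

(** * Positive roots *)

Section Roots.
Context {R : realType} {n : nat} (D : rootData R n).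
Implicit Types (a b x y : 'cV[R]_n) (w : 'M[R]_n).
Local Notation simple := (simple D).
Local Notation theta := (theta D).

Definition pos a : bool := [forall i, 0 <= rcoef simple a i 0].

(** The least integer k for which the affine root [a, nu_a k] is positive. *)
Definition chi a : R := if pos a then 0 else 1.

Lemma rcoefD x y i : rcoef simple (x + y) i 0 =
  rcoef simple x i 0 + rcoef simple y i 0.
Proof. by rewrite /rcoef mulmxDr mxE. Qed.

Lemma rcoefZ c x i : rcoef simple (c *: x) i 0 = c * rcoef simple x i 0.
Proof. by rewrite /rcoef -scalemxAr mxE. Qed.

Lemma rcoefN x i : rcoef simple (- x) i 0 = - rcoef simple x i 0.
Proof. by rewrite -scaleN1r rcoefZ mulN1r. Qed.

Lemma rcoefK x : \sum_i rcoef simple x i 0 *: simple i = x.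
Proof.
rewrite -[RHS](mulKVmx (simple_basis D)) -/(rcoef _ _).
apply/matrixP => k l; rewrite ord1 summxE mxE; apply: eq_bigr => i _.
by rewrite !mxE mulrC.
Qed.

Lemma rcoef_simple i k : rcoef simple (simple i) k 0 = (k == i)%:R.
Proof.
have -> : simple i = simple_mx simple *m delta_mx i 0.
  by rewrite -colE; apply/matrixP => l m; rewrite ord1 !mxE.
by rewrite /rcoef mulKmx ?simple_basis // mxE eqxx andbT.
Qed.

Lemma root_neq0 a : a \in roots D -> a != 0.
Proof. by apply: contraTneq => ->; exact: roots_neq0. Qed.

Lemma nu_gt0 a : a \in roots D -> 0 < nu a.
Proof. by move=> /root_neq0 a0; rewrite divr_gt0 ?dot_gt0. Qed.

Lemma nu_neq0 a : a \in roots D -> nu a != 0.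
Proof. by move=> /nu_gt0 /lt0r_neq0. Qed.

Lemma nuN a : nu (- a) = nu a.
Proof. by rewrite /nu dotNl dotNr opprK. Qed.

Lemma rootN a : a \in roots D -> - a \in roots D.
Proof. by move=> aR; rewrite -refl_id ?root_neq0 // roots_refl. Qed.

Lemma posN a : a \in roots D -> pos (- a) = ~~ pos a.
Proof.
move=> aR; have posn x : (forall i, rcoef simple x i 0 \is a Num.nat) -> pos x.
  by move=> h; apply/forallP => i; rewrite natr_ge0.
have npos : pos a -> pos (- a) -> false.
  move=> /forallP h1 /forallP h2; case/eqP: (root_neq0 aR).
  rewrite -(rcoefK a) big1 // => i _; suff -> : rcoef simple a i 0 = 0.
    by rewrite scale0r.
  by apply/eqP; rewrite eq_le h1 -oppr_ge0 -rcoefN h2.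
case: (simple_sign aR) => /posn h; rewrite h.
  by apply/negP => /(npos h).
by symmetry; apply/negP => /npos /(_ h).
Qed.

Lemma chiN a : a \in roots D -> chi (- a) = 1 - chi a.
Proof.
by move=> aR; rewrite /chi posN //; case: (pos a); rewrite /= ?subr0 ?subrr.
Qed.

Lemma pos_simple i : pos (simple i).
Proof. by apply/forallP => k; rewrite rcoef_simple ler0n. Qed.

Lemma chi_simple i : chi (simple i) = 0.
Proof. by rewrite /chi pos_simple. Qed.

Definition dominant b := forall i, 0 <= dot b (simple i).

Lemma dominant_pos b a : dominant b -> pos a -> 0 <= dot b a.
Proof.
move=> db /forallP pa; rewrite -(rcoefK a) dot_sumr; apply: sumr_ge0 => i _.
by rewrite dotZr mulr_ge0.
Qed.

(** As the root system is reduced, a positive root other than alpha_i has a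
    positive coefficient at some alpha_k with k != i, and s_i keeps it. *)
Lemma pos_refl_simple i a : a \in roots D -> pos a -> a != simple i ->
  pos (refl (simple i) *m a).
Proof.
move=> aR pa ai; have sR : refl (simple i) *m a \in roots D.
  by rewrite roots_refl ?simple_root.
apply: contraNT ai; rewrite -posN // => /forallP pN.
have c0 k : k != i -> rcoef simple a k 0 = 0.
  move=> ki; have := pN k; rewrite rcoefN refl_mul rcoefD rcoefN rcoefZ.
  rewrite rcoef_simple (negbTE ki) mulr0 oppr0 addr0 oppr_ge0 => le0.
  by apply/eqP; rewrite eq_le le0 (forallP pa).
have ea : a = rcoef simple a i 0 *: simple i.
  rewrite -[LHS]rcoefK (bigD1 i) //= big1 ?addr0 // => k ki.
  by rewrite c0 ?scale0r.
have aR' := aR; rewrite ea in aR'.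
case: (roots_reduced (simple_root D i) aR') => c1.
  by rewrite {1}ea c1 scale1r.
by have := forallP pa i; rewrite c1 oppr_ge0 ler10.
Qed.

(** Otherwise s_i(theta) would be a short root above theta. *)
Lemma theta_dominant : dominant theta.
Proof.
move=> i; rewrite leNgt; apply/negP => lt0.
have sR := simple_root D i; have s0 := root_neq0 sR.
have tR : refl (simple i) *m theta \in roots D by rewrite roots_refl ?theta_root.
have := theta_max tR; rewrite (dot_isom (refl_isometry s0)) theta_short.
move=> /(_ erefl i); rewrite refl_mul opprB addrCA subrr addr0 rcoefZ.
rewrite rcoef_simple eqxx mulr1 => /natr_ge0; rewrite dot_coroot leNgt.
by rewrite pmulr_llt0 ?lt0 // invr_gt0 nu_gt0.
Qed.

Lemma pos_theta : pos theta.
Proof.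
have tR := theta_root D; rewrite -[pos _]negbK -posN //; apply/negP => pN.
have := dominant_pos theta_dominant pN; rewrite dotNr oppr_ge0 theta_short.
by rewrite leNgt ltr0n.
Qed.

Lemma nu_theta : nu theta = 1.
Proof. by rewrite /nu theta_short divff // pnatr_eq0. Qed.

(** The elements of W are treated through these two properties, which pass to
    products and, in the form of the transpose, to inverses. *)
Definition aut w : Prop :=
  w^T *m w = 1%:M /\ perm_eq [seq w *m a | a <- roots D] (roots D).

Lemma aut_root w a : aut w -> a \in roots D -> w *m a \in roots D.
Proof. by move=> [_ /perm_mem wR] aR; rewrite -wR map_f. Qed.

Lemma aut_tr w : aut w -> aut w^T.
Proof.
case=> wV wR; split; first by rewrite trmxK; apply: isomV.
have := perm_map (mulmx w^T) wR; rewrite perm_sym -map_comp => h.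
apply: perm_trans h _; rewrite -[X in perm_eq _ X]map_id.
by rewrite (@eq_map _ _ _ id) // => a /=; rewrite isomK.
Qed.

Lemma autM w w' : aut w -> aut w' -> aut (w *m w').
Proof.
case=> wV wR [wV' wR']; split.
  by rewrite trmx_mul mulmxA -(mulmxA w'^T) wV mulmx1.
apply: perm_trans wR; have := perm_map (mulmx w) wR'; rewrite -map_comp.
by rewrite (@eq_map _ _ _ (mulmx (w *m w'))) // => a /=; rewrite mulmxA.
Qed.

Lemma aut_of_sub w : w^T *m w = 1%:M ->
  {in roots D, forall a, w *m a \in roots D} -> aut w.
Proof.
move=> wV wR; split=> //; have u : uniq [seq w *m a | a <- roots D].
  by rewrite map_inj_uniq ?roots_uniq // => x y e; rewrite -(isomK wV x) e isomK.
apply: (uniq_perm u (roots_uniq D)).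
apply: (uniq_min_size u _ _).2; last by rewrite size_map.
by move=> _ /mapP [a aR ->]; exact: wR.
Qed.

Lemma aut1 : aut 1%:M.
Proof.
split; first exact: etrans (mulmx1 _) (trmx1 _ _).
by rewrite (@eq_map _ _ _ id) ?map_id // => a; rewrite mul1mx.
Qed.

Lemma autN1 : aut (- 1%:M).
Proof.
apply: aut_of_sub => [|a aR]; last by rewrite mulNmx mul1mx rootN.
have -> : (- (1%:M))^T = - (1%:M)^T :> 'M[R]_n.
    by apply/matrixP => i j; rewrite !mxE.
  by rewrite mulNmx mulmxN opprK (proj1 aut1).
Qed.

Lemma aut_refl a : a \in roots D -> aut (refl a).
Proof.
move=> aR; apply: aut_of_sub (refl_isometry (root_neq0 aR)) _ => b.
exact: roots_refl.
Qed.

Lemma inW_aut w : inW D w -> aut w.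
Proof.
case=> j [l ->]; rewrite /wword; elim/big_rec: _ => [|i x _ xA]; first exact: aut1.
by apply: autM xA; apply: aut_refl; apply: simple_root.
Qed.

(** * Sums over the roots of a given length *)

Implicit Types (F : 'cV[R]_n -> R) (v : R).

Lemma sum_aut v w F : aut w ->
  \sum_(a <- roots D | nu a == v) F (w *m a) = \sum_(a <- roots D | nu a == v) F a.
Proof.
move=> [wV wR]; rewrite -[RHS](perm_big _ wR) big_map.
by apply: eq_bigl => a; rewrite nu_isom.
Qed.

Lemma sum_posroots_chi v F :
  \sum_(a <- posroots D | nu a == v) F a =
  \sum_(a <- roots D | nu a == v) (1 - chi a) * F a.
Proof.
rewrite big_filter_cond [RHS](bigID (fun a => pos a)) /=.
rewrite [X in _ = _ + X]big1 => [|a /andP [_ /negbTE na]]; last first.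
  by rewrite /chi na subrr mul0r.
rewrite addr0; apply: eq_big => [a|a /andP [pa _]]; first by rewrite andbC.
by rewrite /chi [pos a]pa subr0 mul1r.
Qed.

(** The set of all roots, unlike that of the positive ones, can be reindexed by
    any symmetry; oddness allows to pass from one to the other. *)
Lemma sum_posroots_sgn v F : {in roots D, forall a, F (- a) = - F a} ->
  2 * \sum_(a <- posroots D | nu a == v) F a =
  \sum_(a <- roots D | nu a == v) (1 - 2 * chi a) * F a.
Proof.
move=> Fodd; rewrite sum_posroots_chi mulr_natl mulr2n.
have e : \sum_(a <- roots D | nu a == v) chi a * F a =
    - \sum_(a <- roots D | nu a == v) (1 - chi a) * F a.
  rewrite -(sum_aut v _ autN1) -sumrN big_seq_cond [RHS]big_seq_cond.
  apply: eq_bigr => a /andP [aR _].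
  by rewrite mulNmx mul1mx chiN // Fodd // mulrN.
transitivity (\sum_(a <- roots D | nu a == v) (1 - chi a) * F a
              - \sum_(a <- roots D | nu a == v) chi a * F a).
  by rewrite e opprK.
by rewrite -sumrB; apply: eq_bigr => a _; ring.
Qed.

(** Adding to the signed sum over all roots the one reindexed by s_b leaves only
    the roots whose sign s_b changes. *)
Lemma sum_posroots_refl v b F : b \in roots D ->
  {in roots D, forall a, F (- a) = - F a} ->
  {in roots D, forall a, F (refl b *m a) = - F a} ->
  4 * \sum_(a <- posroots D | nu a == v) F a =
  2 * \sum_(a <- roots D | nu a == v) (chi (refl b *m a) - chi a) * F a.
Proof.
move=> bR Fodd Fb; rewrite (_ : 4 = 2 * 2) -?mulrA ?sum_posroots_sgn //; last by ring.
rewrite mulr_natl mulr2n -{1}(sum_aut v _ (aut_refl bR)) -big_split /= mulr_sumr.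
rewrite big_seq_cond [RHS]big_seq_cond; apply: eq_bigr => a /andP [aR _].
by rewrite Fb //; ring.
Qed.

(** The contributions of b and -b are equal; those of the other roots are
    nonnegative. *)
Lemma sum_posroots_ge v b F : b \in roots D ->
  {in roots D, forall a, F (- a) = - F a} ->
  {in roots D, forall a, F (refl b *m a) = - F a} ->
  {in roots D, forall a, pos a -> ~~ pos (refl b *m a) -> 0 <= F a} ->
  (nu b == v)%:R * ((1 - 2 * chi b) * F b) <=
  \sum_(a <- posroots D | nu a == v) F a.
Proof.
move=> bR Fodd Fb Fpos; have e := sum_posroots_refl v bR Fodd Fb.
rewrite -(ler_pM2l (_ : 0 < 4)) ?ltr0n // {}e.
set G := fun a => (chi (refl b *m a) - chi a) * F a.
have G0 a : a \in roots D -> 0 <= G a.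
  move=> aR; have sR := roots_refl bR aR.
  have F2 := Fpos _ (rootN aR); rewrite mulmxN !posN // negbK Fodd // in F2.
  have F1 := Fpos _ aR; rewrite /G /chi.
  case: (pos a) F1 F2; case: (pos (refl b *m a)) => F1 F2; rewrite ?subrr ?mul0r //.
    by rewrite subr0 mul1r F1.
  by rewrite sub0r mulN1r F2.
have Gb : G b = (1 - 2 * chi b) * F b.
  by rewrite /G refl_id ?root_neq0 // chiN //; congr (_ * _); ring.
have GNb : G (- b) = (1 - 2 * chi b) * F b.
  rewrite /G mulmxN refl_id ?root_neq0 // opprK chiN // Fodd //; ring.
rewrite -big_filter; have [<-|bv] := eqVneq; last first.
  rewrite mul0r mulr0 mulr_ge0 ?ler0n // big_filter big_seq_cond.
  by apply: sumr_ge0 => a /andP [aR _]; exact: G0.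
set l := filter _ _; have lR : {subset l <= roots D} by apply: mem_subseq; exact: filter_subseq.
have lu : uniq l by rewrite filter_uniq ?roots_uniq.
have bl : b \in l by rewrite mem_filter eqxx.
have bNb : - b != b.
  apply: contra_neq (root_neq0 bR) => e; apply: (scalerI (_ : 2 != 0 :> R)).
    by rewrite pnatr_eq0.
  by rewrite scaler0 scaler_nat mulr2n -{1}e addNr.
have Nbl : - b \in rem b l by rewrite mem_rem_uniq // !inE bNb mem_filter nuN eqxx rootN.
rewrite (perm_big _ (perm_to_rem bl)) big_cons.
rewrite (perm_big _ (perm_to_rem Nbl)) big_cons mul1r.
rewrite -/(G b) -/(G (- b)) Gb GNb.
have S0 : 0 <= \sum_(a <- rem (- b) (rem b l)) G a.
  rewrite big_seq; apply: sumr_ge0 => a al; apply: G0; apply: lR.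
  exact: mem_rem (mem_rem al).
move: S0; rewrite /G; set S := (\sum_(a <- _) _); set y := _ * F b => S0.
by rewrite /=; lra.
Qed.

Lemma pos_add a b c : pos a -> pos b -> 0 <= c -> pos (a + c *: b).
Proof.
move=> /forallP pa /forallP pb c0; apply/forallP => i.
by rewrite rcoefD rcoefZ addr_ge0 ?mulr_ge0.
Qed.

(** This is 2 (rho_v^vee, b), the exponent of the variable t_v^(1/2) in
    q^(rho_k, b). *)
Definition height v b : R := \sum_(a <- posroots D | nu a == v) dot (coroot a) b.

Lemma heightE v b : height v b = 2 * dot (rhov D v) b.
Proof.
rewrite /rhov dotZl mulrA invfM mulrA divff ?pnatr_eq0 // mul1r dot_suml mulr_sumr.
apply: eq_bigr => a /eqP <-.
by rewrite dotC dot_coroot dotC mulrC.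
Qed.

Lemma heightN v b : height v (- b) = - height v b.
Proof. by rewrite /height -sumrN; apply: eq_bigr => a _; rewrite dotNr. Qed.

Lemma corootN a : coroot (- a) = - coroot a.
Proof. by rewrite /coroot dotNl dotNr opprK scalerN. Qed.

Lemma coroot_self a : a \in roots D -> dot a (coroot a) = 2.
Proof.
move=> aR; have d0 : dot a a != 0 by rewrite gt_eqF ?dot_gt0 ?root_neq0.
by rewrite dot_coroot /nu; field.
Qed.

Lemma dot_coroot_refl b a : b \in roots D ->
  dot (coroot (refl b *m a)) b = - dot (coroot a) b.
Proof.
move=> bR; have bV := refl_isometry (root_neq0 bR).
rewrite (coroot_isom bV) -[in RHS](dot_isom bV) refl_id ?root_neq0 //.
by rewrite dotNr opprK.
Qed.

(** s_b(a) = a - (a, b^vee) b, and adding a nonnegative multiple of a positive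
    root to a positive root cannot make it negative. *)
Lemma inversion_dot a b : a \in roots D -> pos a -> b \in roots D ->
  ~~ pos (refl b *m a) -> if pos b then 0 < dot (coroot a) b else dot (coroot a) b < 0.
Proof.
move=> aR pa bR; rewrite refl_mul (dotC (coroot a)) !dot_coroot (dotC b).
have va := nu_gt0 aR; have vb := nu_gt0 bR.
case: ifP => pb npos.
  rewrite divr_gt0 // ltNge; apply: contra npos => le0.
  rewrite -scaleNr pos_add // oppr_ge0 -(pmulr_lle0 _ vb) divfK //.
  by rewrite gt_eqF.
rewrite pmulr_llt0 ?invr_gt0 // ltNge; apply: contra npos => ge0.
by rewrite -scalerN pos_add ?posN ?pb // divr_ge0 // ltW.
Qed.

(** Each positive root made negative by s_b contributes a positive integer, and b
    itself contributes (b^vee, b) = 2. *)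
Lemma height_ge v b : b \in roots D -> pos b -> (nu b == v)%:R * 2 <= height v b.
Proof.
move=> bR pb.
have := @sum_posroots_ge v b (fun a => dot (coroot a) b) bR.
rewrite /chi pb mulr0 subr0 mul1r dotC coroot_self //; apply.
- by move=> a aR; rewrite corootN dotNl.
- by move=> a aR; rewrite dot_coroot_refl.
by move=> a aR pa /(inversion_dot aR pa bR); rewrite pb => /ltW.
Qed.

(** The length difference l_v(w s_b) - l_v(w), where l_v counts the positive
    roots of length v made negative. *)
Definition flips v w b : R :=
  \sum_(a <- posroots D | nu a == v) (chi (w *m (refl b *m a)) - chi (w *m a)).

(** If s_b makes a > 0 negative, then w(a) = w(s_b(a)) + c w(b) with c > 0, so
    that w s_b makes a negative if w does.  The root b contributes 1. *)
Lemma flips_ge v w b : aut w -> b \in roots D -> pos b -> pos (w *m b) ->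
  (nu b == v)%:R <= flips v w b.
Proof.
move=> wA bR pb pwb.
have := @sum_posroots_ge v b (fun a => chi (w *m (refl b *m a)) - chi (w *m a)) bR.
rewrite /= refl_id ?root_neq0 // mulmxN chiN ?(aut_root wA) //.
rewrite [chi b]/chi [chi (w *m b)]/chi pb pwb.
rewrite mulr0 !subr0 !mulr1; apply.
- move=> a aR; by rewrite !mulmxN !chiN ?(aut_root wA) ?roots_refl //; ring.
- by move=> a aR; rewrite refl_refl ?root_neq0 // opprB.
move=> a aR pa npos; have := inversion_dot aR pa bR npos; rewrite pb => gt0.
have imp : pos (w *m (refl b *m a)) -> pos (w *m a).
  rewrite (_ : w *m a = w *m (refl b *m a) + dot a (coroot b) *: (w *m b)).
    move=> h; apply: pos_add => //; have := gt0; rewrite dotC !dot_coroot.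
    rewrite pmulr_lgt0 ?invr_gt0 ?nu_gt0 // => h1.
    by rewrite dotC divr_ge0 ?ltW ?nu_gt0.
  by rewrite refl_mul mulmxBr -scalemxAr subrK.
rewrite subr_ge0 /chi; case: (pos (w *m a)) imp => imp; first by case: ifP.
by case: ifP => // /imp.
Qed.

(** If s_b makes a > 0 negative, then (a^vee, b) <= -1, which outweighs the
    contribution of a to the length difference; for a = -b it is -2. *)
Lemma flips_le v w b : aut w -> b \in roots D -> ~~ pos b ->
  (nu b == v)%:R - flips v w b <= - height v b.
Proof.
move=> wA bR pb.
have := @sum_posroots_ge v b (fun a => - dot (coroot a) b +
  (chi (w *m (refl b *m a)) - chi (w *m a))) bR.
rewrite big_split /= sumrN -/(height v b) -/(flips v w b) => h.
rewrite lerBlDr; apply: le_trans (h _ _ _) => {h}.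
- rewrite refl_id ?root_neq0 // mulmxN chiN ?(aut_root wA) // [chi b]/chi (negbTE pb).
  rewrite dotC coroot_self // -[X in X <= _]mulr1 ler_wpM2l ?ler0n //.
  by rewrite /chi; case: ifP => _; lra.
- move=> a aR; by rewrite corootN dotNl !mulmxN !chiN ?(aut_root wA) ?roots_refl //; ring.
- by move=> a aR; rewrite refl_refl ?root_neq0 // dot_coroot_refl // ; ring.
move=> a aR pa npos; have := inversion_dot aR pa bR npos; rewrite (negbTE pb).
have /intrP [z ->] : dot (coroot a) b \is a Num.int by rewrite dotC (roots_int aR bR).
rewrite ltrz0 => z0; have : z%:~R <= (-1)%:~R :> R.
  by rewrite ler_int -ltzD1.
rewrite mulrN1z.
by rewrite /chi; do 2!case: ifP => _; lra.
Qed.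

End Roots.

(** * The exchange condition *)

Section Exchange.
Context {T : eqType} {I : Type} (s : I -> T -> T) (a : I -> T) (P : T -> Prop).

Definition act (t : seq I) (x : T) : T := foldr s x t.

Definition reduced (t : seq I) := forall t', act t' =1 act t -> (size t <= size t')%N.

(** In the applications P holds for the positive roots, finite or affine, and a i
    is the only one that s i makes negative. *)
Hypothesis sK : forall i, involutive (s i).
Hypothesis P_simple : forall i, P (a i).
Hypothesis P_refl : forall i x, P x -> x != a i -> P (s i x).
Hypothesis act_conj : forall t i j, act t (a i) = a j ->
  forall x, act t (s i x) = s j (act t x).

Lemma act_cat t1 t2 x : act (t1 ++ t2) x = act t1 (act t2 x).
Proof. exact: foldr_cat. Qed.

Lemma act_rcons t i x : act (rcons t i) x = act t (s i x).
Proof. by rewrite -cats1 act_cat. Qed.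

Lemma act_rev t x : act (rev t) (act t x) = x.
Proof. by elim: t x => // i t IH x; rewrite rev_cons act_rcons /= sK IH. Qed.

Lemma reduced_infix t1 t2 t3 : reduced (t1 ++ t2 ++ t3) -> reduced t2.
Proof.
move=> red t' e; have := red (t1 ++ t' ++ t3).
by rewrite !size_cat leq_add2l leq_add2r; apply => x; rewrite !act_cat e.
Qed.

Lemma reduced_rev t : reduced t -> reduced (rev t).
Proof.
move=> red t' e; rewrite size_rev -(size_rev t'); apply: red => x.
by rewrite -{1}(act_rev t x) -e act_rev.
Qed.

(** If reading the word from the right first leaves P at the letter j, then the
    root is a j at this point, so that the rest of the word conjugates s i to
    s j, and both letters can be deleted. *)
Lemma reduced_pos t i : reduced (rcons t i) -> P (act t (a i)).
Proof.
elim: t => [|j t IH] red //=.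
have {}IH : P (act t (a i)).
  by apply: IH; apply: (@reduced_infix [:: j] _ [::]); rewrite cats0.
have [e|] := eqVneq (act t (a i)) (a j); last exact: P_refl.
have := red t; rewrite rcons_cons /= size_rcons ltnNge leqnSn => abs.
suff : false by []. apply: abs => x.
by rewrite /= -/(act _ _) act_rcons (act_conj e) sK.
Qed.

End Exchange.

(** * Affine roots and signed inversion counts *)

Section Affine.
Context {R : realType} {n : nat} (D : rootData R n).
Implicit Types (a b x y : 'cV[R]_n) (w : 'M[R]_n) (e z : affv (R := R) (n := n)).
Local Notation simple := (simple D).
Local Notation theta := (theta D).
Local Notation asimple := (asimple D).
Local Notation sref i := (arefl (asimple i)).
Local Notation pos := (pos D).
Local Notation chi := (chi D).

Definition affroot e := e.1 \in roots D /\ e.2 / nu e.1 \is a Num.int.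

Definition affpos e := affroot e /\ chi e.1 <= e.2 / nu e.1.

(** The affine maps of the extended affine Weyl group: atrans b after w is
    afun w (- w^-1 b). *)
Definition afun w c z : affv (R := R) (n := n) := (w *m z.1, z.2 + dot c z.1).

Definition affaut (g : affv -> affv) := exists w c,
  [/\ aut D w, {in roots D, forall a, dot c a / nu a \is a Num.int} & g =1 afun w c].

Lemma arefl_afun g w c e z : w^T *m w = 1%:M -> g =1 afun w c ->
  g (arefl e z) = arefl (g e) (g z).
Proof.
move=> wV gE; rewrite !gE /afun /arefl /=; congr pair.
  by rewrite (coroot_isom wV) (dot_isom wV) mulmxBr -scalemxAr.
by rewrite (coroot_isom wV) (dot_isom wV) dotBr dotZr; ring.
Qed.

Lemma arefl_aff e z : arefl e z = afun (refl e.1) (- e.2 *: coroot e.1) z.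
Proof.
rewrite /arefl /afun refl_mul; congr pair.
by rewrite dotZl dotC mulNr mulrC.
Qed.

Lemma areflK e : e.1 != 0 -> involutive (arefl e).
Proof.
move=> e0 [x t]; rewrite !arefl_aff /afun /= refl_refl //; congr pair.
rewrite !(dotZl (- e.2)) (_ : dot _ (refl _ *m _) = - dot (coroot e.1) x); first by ring.
rewrite dotC dot_mulmx refl_tr -coroot_isom ?refl_isometry // refl_id //.
by rewrite corootN dotNr dotC.
Qed.

Lemma affaut_comp g h : affaut g -> affaut h -> affaut (g \o h).
Proof.
case=> w [c [wA cI gE]] [w' [c' [wA' cI' hE]]].
exists (w *m w'), (c' + w'^T *m c); split; first exact: autM.
  move=> a aR; rewrite dotDl dot_mulmx trmxK mulrDl rpredD ?cI' //.
  by rewrite -(nu_isom (proj1 wA')) cI ?aut_root.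
move=> z; rewrite /= gE hE /afun /= mulmxA dotDl dot_mulmx trmxK.
by rewrite addrA.
Qed.

Lemma affaut_refl e : affroot e -> affaut (arefl e).
Proof.
case=> eR eI; exists (refl e.1), (- e.2 *: coroot e.1).
split; first exact: aut_refl.
  move=> a aR; have va := nu_neq0 aR; have ve := nu_neq0 eR.
  rewrite (_ : _ / _ = - (e.2 / nu e.1) * dot e.1 (coroot a)).
    by rewrite rpredM ?rpredN ?(roots_int aR eR).
  by rewrite dotZl (dotC (coroot _)) !dot_coroot (dotC a); field; rewrite va ve.
by move=> z; rewrite arefl_aff.
Qed.

Lemma affaut_root g e : affaut g -> affroot e -> affroot (g e).
Proof.
case=> w [c [wA cI gE]] [eR eI]; rewrite gE /affroot /=; split.
  exact: aut_root.
by rewrite (nu_isom (proj1 wA)) mulrDl rpredD ?cI.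
Qed.

Lemma asimple_root i : affroot (asimple i).
Proof.
rewrite /affroot /asimple; case: unliftP => [k _|_] /=.
  by rewrite mul0r rpred0 simple_root.
by rewrite nuN nu_theta divr1 rpred1 rootN // theta_root.
Qed.

Lemma srefK i : involutive (sref i).
Proof. by apply: areflK; case: (asimple_root i) => /root_neq0. Qed.

Lemma affaut_act t : affaut (act (fun i => sref i) t).
Proof.
elim: t => [|i t IH].
  exists 1%:M, 0; split; first exact: aut1.
    by move=> a _; rewrite dot0l mul0r rpred0.
  by case=> x r; rewrite /afun dot0l mul1mx addr0.
exact: affaut_comp (affaut_refl (asimple_root i)) IH.
Qed.

(** With d = (theta, b^vee), the vector theta - (d / 2) b has the squared norm
    2 - d^2 nu_b / 2, which is positive unless b = theta or b = - theta. *)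
Lemma dot_theta b : b \in roots D -> b != theta -> b != - theta ->
  [\/ dot (coroot b) theta = 0, dot (coroot b) theta = 1 |
      dot (coroot b) theta = -1].
Proof.
move=> bR bt bNt; have tR := theta_root D.
have /intrP [d dE] : dot theta (coroot b) \is a Num.int by rewrite (roots_int bR tR).
rewrite dotC dE; have vb := nu_gt0 bR.
have bb : dot b b = 2 * nu b by rewrite /nu; field.
have tb : dot theta b = d%:~R * nu b.
  by rewrite -dE dot_coroot divfK // gt_eqF.
have nub : 1 <= nu b by rewrite /nu ler_pdivlMr ?ltr0n // mul1r (short_min bR).
have u0 : theta - (d%:~R / 2) *: b != 0.
  apply/negP; rewrite subr_eq0 => /eqP te.
  have := tR; rewrite {1}te => /(roots_reduced bR) [c1|c1]; move: bt bNt; rewrite te c1.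
    by rewrite scale1r eqxx.
  by rewrite scaleN1r opprK eqxx.
have := dot_gt0 u0; rewrite dotBl !dotBr !dotZl !dotZr theta_short (dotC b) tb bb.
move=> gt0; have : d%:~R ^+ 2 * nu b < 4 by lra.
move=> lt4; have : d%:~R ^+ 2 < 4 :> R.
  by apply: le_lt_trans lt4; rewrite ler_peMr ?sqr_ge0.
rewrite -[4]/(4%:~R) -rmorphXn ltr_int => d4.
have [d0|[d0|d0]] : d = 0 \/ d = 1 \/ d = -1 by nia.
- by rewrite d0; constructor 1.
- by rewrite d0; constructor 2.
by rewrite d0; constructor 3; rewrite mulrN1z.
Qed.

Lemma root_neqN a : a \in roots D -> (a == - a) = false.
Proof.
move=> aR; apply/negP => /eqP e; have := posN aR; rewrite -e.
by case: (pos a).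
Qed.

Lemma chi_refl_simple k b : b \in roots D ->
  chi (refl (simple k) *m b) - chi b = (b == simple k)%:R - (b == - simple k)%:R.
Proof.
move=> bR; have sR := simple_root D k.
have [->|bs] := eqVneq b (simple k).
  by rewrite root_neqN // refl_id ?(root_neq0 sR) // chiN // chi_simple !subr0.
have [->|bNs] := eqVneq b (- simple k).
  by rewrite mulmxN refl_id ?(root_neq0 sR) // opprK chiN // chi_simple /=; ring.
rewrite subrr; apply/eqP; rewrite subr_eq0; apply/eqP.
rewrite /chi; case: (boolP (pos b)) => pb; first by rewrite pos_refl_simple.
rewrite ifN // -posN ?roots_refl // -mulmxN pos_refl_simple ?rootN ?posN //.
by rewrite -(inj_eq oppr_inj) opprK.
Qed.

Lemma dominant_gt0 b a : dominant D b -> a \in roots D -> 0 < dot b a -> pos a.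
Proof.
move=> db aR; apply: contraTT; rewrite -posN // => /(dominant_pos db).
by rewrite dotNr oppr_ge0 leNgt.
Qed.

(** By dominance, the sign of (b, theta) determines the sign of b or of
    s_theta(b) whenever it is nonzero. *)
Lemma chi_refl_theta b : b \in roots D ->
  chi (refl theta *m b) - chi b - dot (coroot b) theta =
  (b == - theta)%:R - (b == theta)%:R.
Proof.
move=> bR; have tR := theta_root D; have t0 := root_neq0 tR.
have chit : chi theta = 0 by rewrite /chi pos_theta.
have [->|bNt] := eqVneq b (- theta).
  rewrite mulmxN refl_id // opprK chiN // chit corootN dotNl dotC (coroot_self tR) //.
  by rewrite eq_sym root_neqN //=; ring.
have [->|bt] := eqVneq b theta.
  by rewrite refl_id // chiN // chit dotC (coroot_self tR) //=; ring.
have sR := roots_refl tR bR; have vb := nu_gt0 bR.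
have dotE0 : dot theta b = nu b * dot (coroot b) theta.
  by rewrite (dotC (coroot b)) dot_coroot mulrC divfK // gt_eqF.
have dot_s : dot theta (refl theta *m b) = - dot theta b.
  by rewrite dotC dot_mulmx refl_tr refl_id // dotNr dotC.
rewrite subrr; case: (dot_theta bR bt bNt) => d; rewrite d in dotE0 *.
- rewrite refl_mul (_ : dot b (coroot theta) = 0) ?scale0r ?subr0 ?subrr //.
  by rewrite dot_coroot dotC dotE0 mulr0 mul0r.
- rewrite mulr1 in dotE0; rewrite /chi (dominant_gt0 (theta_dominant D) bR) ?dotE0 //.
  rewrite ifN ?subr0 ?subrr // -posN //; apply: (dominant_gt0 (theta_dominant D)).
    exact: rootN.
  by rewrite dotNr dot_s opprK dotE0.
rewrite mulrN1 in dotE0.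
rewrite /chi (dominant_gt0 (theta_dominant D) sR) ?dot_s ?dotE0 ?opprK //.
rewrite ifN; first by ring.
rewrite -posN //; apply: (dominant_gt0 (theta_dominant D)); first exact: rootN.
by rewrite dotNr dotE0 opprK.
Qed.

(** The affine roots over b are [b, nu_b k], and s_i shifts k by
    (s_i [b, 0]).2 / nu_b.  The left-hand side is the number of positive affine
    roots over b that s_i makes negative, counted negatively for those going the
    other way, and alpha_i is the only positive one that becomes negative. *)
Lemma sref_chi i b : b \in roots D ->
  chi (sref i (b, 0)).1 - chi b - (sref i (b, 0)).2 / nu b =
  (b == (asimple i).1)%:R - (b == - (asimple i).1)%:R.
Proof.
move=> bR; rewrite arefl_aff /afun /= /asimple.
case: unliftP => [k _|_] /=.
  by rewrite oppr0 scale0r dot0l addr0 mul0r subr0 chi_refl_simple.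
rewrite opprK refl_opp -chi_refl_theta // scaleN1r corootN opprK add0r.
rewrite (dotC (coroot theta)) dot_coroot nu_theta divr1.
by rewrite (dotC (coroot b)) dot_coroot dotC.
Qed.

Lemma asimple_chi i : (asimple i).2 / nu (asimple i).1 = chi (asimple i).1.
Proof.
rewrite /asimple; case: unliftP => [k _|_] /=; first by rewrite mul0r chi_simple.
by rewrite nuN nu_theta divr1 chiN ?theta_root // /chi pos_theta subr0.
Qed.

Lemma affpos_simple i : affpos (asimple i).
Proof. by split; [exact: asimple_root | rewrite asimple_chi]. Qed.

Lemma chi_int b : chi b \is a Num.int.
Proof. by rewrite /chi; case: ifP => _; rewrite ?rpred0 ?rpred1. Qed.

Lemma affpos_refl i e : affpos e -> e != asimple i -> affpos (sref i e).
Proof.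
move=> [eR ep] ei; have rR := affaut_root (affaut_refl (asimple_root i)) eR.
split=> //; have [aR aI] := asimple_root i; case: eR => bR bI.
have refl1 : (sref i e).1 = refl (asimple i).1 *m e.1.
  by rewrite arefl_aff.
have nus : nu (sref i e).1 = nu e.1.
  by rewrite refl1 (nu_isom (refl_isometry (root_neq0 aR))).
have refl2 : (sref i e).2 = e.2 + (sref i (e.1, 0)).2.
  by rewrite !arefl_aff /= add0r.
have chiE := sref_chi i bR.
rewrite (_ : (sref i (e.1, 0)).1 = (sref i e).1) in chiE; last by rewrite !arefl_aff.
suff : chi e.1 + ((e.1 == (asimple i).1)%:R - (e.1 == - (asimple i).1)%:R) <=
    e.2 / nu e.1.
  by rewrite -chiE nus refl2; set h := (sref i (_, _)).2; lra.
have [be|_] := eqVneq e.1 (asimple i).1; last first.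
  by rewrite sub0r; apply: le_trans ep; rewrite gerDl oppr_le0 ler0n.
rewrite {2}be root_neqN // subr0.
have lt : chi e.1 < e.2 / nu e.1.
  rewrite lt_neqAle ep andbT; apply: contra ei => /eqP ec.
  rewrite -pair_eqE /= /pair_eq be eqxx /=; apply/eqP; move: ec.
  by rewrite be -asimple_chi => /(divIf (nu_neq0 aR)).
move: lt; have /intrP [z ->] := chi_int e.1; have /intrP [y ->] := bI.
by rewrite ltr_int -[true%:R]/(1%:~R) -intrD ler_int -lezD1.
Qed.

Lemma act_sref_conj t i j : act (fun i => sref i) t (asimple i) = asimple j ->
  forall z, act (fun i => sref i) t (sref i z) = sref j (act (fun i => sref i) t z).
Proof.
move=> e z; case: (affaut_act t) => w [c [[wV _] _ gE]].
by rewrite (arefl_afun _ _ wV gE) e.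
Qed.

(** The summand is the signed number of affine roots over w(a) whose sign is
    changed by g; it is odd in a.  The sum is therefore that of the signs of
    w^-1(b) over the positive affine roots [b, v k], with nu_b = v, made
    negative by g. *)
Definition sinv v (g : affv -> affv) w : R :=
  \sum_(a <- posroots D | nu a == v)
    (chi (g (w *m a, 0)).1 - chi (w *m a) - (g (w *m a, 0)).2 / v).

Lemma sum_posroots_delta v b : b \in roots D ->
  \sum_(a <- posroots D | nu a == v) ((a == b)%:R - (a == - b)%:R) =
  (nu b == v)%:R * (1 - 2 * chi b).
Proof.
move=> bR; rewrite sum_posroots_chi; set G := fun a b => (1 - chi a) * (a == b)%:R.
have delta x : x \in roots D ->
    \sum_(a <- roots D | nu a == v) G a x = (nu x == v)%:R * (1 - chi x).
  move=> xR; rewrite big_mkcond (bigD1_seq x) ?roots_uniq //= big1_seq ?addr0.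
    by rewrite /G eqxx mulr1; case: ifP => _; rewrite ?mul1r ?mul0r.
  by move=> a /andP [/negbTE ax _]; rewrite /G ax mulr0; case: ifP.
transitivity (\sum_(a <- roots D | nu a == v) (G a b - G a (- b))).
  by apply: eq_bigr => a _; rewrite /G mulrBr.
rewrite sumrB !delta ?rootN // nuN chiN //; ring.
Qed.

(** Composing with s_i changes only the summands at plus or minus w^-1(e.1), where
    e is the affine root that g maps to alpha_i. *)
Lemma sinv_refl v g w i e : affaut g -> aut D w -> affroot e -> g e = asimple i ->
  sinv v (fun z => sref i (g z)) w =
  sinv v g w + (nu e.1 == v)%:R * (1 - 2 * chi (w^T *m e.1)).
Proof.
move=> gA wA [eR eI] ge; have [wV _] := wA.
have tA := aut_tr wA; have tR := aut_root tA eR.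
rewrite -(nu_isom (proj1 tA)) -sum_posroots_delta // /sinv -big_split /=.
rewrite !big_filter_cond big_seq_cond [RHS]big_seq_cond.
apply: eq_bigr => a /and3P [aR pa /eqP av].
case: gA => M [c [MA cI gE]].
have waR := aut_root wA aR; have MwaR := aut_root MA waR.
have al : (asimple i).1 = M *m e.1 by rewrite -ge gE.
have MwaE x : (M *m (w *m a) == M *m x) = (a == w^T *m x).
  apply/eqP/eqP => [|->]; last by rewrite isomKV.
  by move/(congr1 (mulmx M^T)); rewrite !(isomK (proj1 MA)) => <-; rewrite isomK.
have h := sref_chi i MwaR.
rewrite (nu_isom (proj1 MA)) (nu_isom wV) av in h.
have d1 : (M *m (w *m a) == (asimple i).1) = (a == w^T *m e.1).
  by rewrite al MwaE.
have d2 : (M *m (w *m a) == - (asimple i).1) = (a == - (w^T *m e.1)).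
  by rewrite al -!mulmxN MwaE.
rewrite d1 d2 in h; by rewrite -h !gE /arefl /afun /=; ring.
Qed.

Lemma awordE j l z :
  aword D j l z = act (fun i => sref i) (rev [seq j k | k <- index_iota 1 l.+1]) z.
Proof.
rewrite -map_rev /aword; elim: (rev _) => [|k r IH]; first by rewrite big_nil.
by rewrite big_cons /acomp /= IH.
Qed.

Lemma arootE j k :
  aroot D j k = act (fun i => sref i) [seq j i | i <- index_iota 1 k] (asimple (j k)).
Proof.
rewrite /aroot; elim: (index_iota 1 k) (asimple _) => [|i r IH] z.
  by rewrite big_nil.
by rewrite big_cons /acomp /= IH.
Qed.

Lemma index_iotaSr m k : (m <= k)%N -> index_iota m k.+1 = rcons (index_iota m k) k.
Proof. by move=> mk; rewrite /index_iota subSn // -addn1 iotaD subnKC // cats1. Qed.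

Lemma awordS j l z : aword D j l.+1 z = sref (j l.+1) (aword D j l z).
Proof. by rewrite !awordE (@index_iotaSr 1 l.+1) // map_rcons rev_rcons. Qed.

Lemma aword_aroot j l : aword D j l (aroot D j l.+1) = asimple (j l.+1).
Proof. by rewrite awordE arootE act_rev //; exact: srefK. Qed.

Lemma affaut_aword j l : affaut (aword D j l).
Proof.
have [w [c [wA cI gE]]] := affaut_act (rev [seq j k | k <- index_iota 1 l.+1]).
by exists w, c; split=> // z; rewrite awordE.
Qed.

Lemma affroot_aroot j k : affroot (aroot D j k).
Proof.
by rewrite arootE; exact: affaut_root (affaut_act _) (asimple_root _).
Qed.

(** By sinv_refl, both sides change by the same amount at each letter. *)
Lemma sum_sign_aroot v j l w : aut D w ->
  \sum_(1 <= k < l.+1) (nu (aroot D j k).1 == v)%:R *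
     (1 - 2 * chi (w^T *m (aroot D j k).1)) = sinv v (aword D j l) w.
Proof.
move=> wA; elim: l => [|l IH].
  rewrite big_geq // /sinv big1 // => a _.
  by rewrite /aword big_nil /= mul0r; ring.
rewrite big_nat_recr //= IH.
rewrite -(sinv_refl v (affaut_aword j l) wA (affroot_aroot j l.+1) (aword_aroot j l)).
by apply: eq_bigr => a _; rewrite awordS.
Qed.

(** Let N and M be the sums on the left and on the right.  By the signed count,
    2 N - 2 M is 1 or 0, according to the length of the i-th root, minus sinv for
    (g s_e, w), plus sinv for (g, s_e w), where g is the word of length i - 1.
    Since g (s_e (w a)) enters both, there remain
    the length difference flips and the translation part of s_e. *)
Lemma aroot_count v j i w (e := aroot D j i) (b := w^T *m e.1) :
  (0 < i)%N -> aut D w -> pos e.1 ->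
  2 * \sum_(1 <= k < i.+1)
     (nu (aroot D j k).1 == v)%:R * chi (w^T *m (aroot D j k).1)
  <= Num.max 0 (- height D v b) - e.2 / nu e.1 * height D v b +
     2 * \sum_(1 <= k < i)
     (nu (aroot D j k).1 == v)%:R * chi (w^T *m (refl e.1 *m (aroot D j k).1)).
Proof.
case: i @e @b => [//|l] e b _ wA pe; have [wV _] := wA.
have [eR eI] := affroot_aroot j l.+1; rewrite -/e in eR eI pe.
have sA := aut_refl eR; have swA := autM sA wA; have tA := aut_tr wA.
have bR : b \in roots D by exact: (aut_root tA eR).
pose d k : R := (nu (aroot D j k).1 == v)%:R.
have sumE w' m : aut D w' ->
    2 * \sum_(1 <= k < m.+1) d k * chi (w'^T *m (aroot D j k).1) =
    \sum_(1 <= k < m.+1) d k - sinv v (aword D j m) w'.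
  move=> w'A; rewrite -sum_sign_aroot // -sumrB mulr_sumr.
  by apply: eq_bigr => k _; rewrite -/(d k); ring.
have -> : \sum_(1 <= k < l.+1) d k * chi (w^T *m (refl e.1 *m (aroot D j k).1)) =
    \sum_(1 <= k < l.+1) d k * chi ((refl e.1 *m w)^T *m (aroot D j k).1).
  by apply: eq_bigr => k _; rewrite trmx_mul refl_tr -mulmxA.
rewrite !sumE // [in X in X <= _]big_nat_recr //= -/e.
have -> : sinv v (aword D j l.+1) w = sinv v (aword D j l) (refl e.1 *m w) +
    flips D v w b + e.2 / nu e.1 * height D v b.
  rewrite /height mulr_sumr /flips /sinv -!big_split /=.
  rewrite !big_filter_cond big_seq_cond [RHS]big_seq_cond.
  apply: eq_bigr => a /and3P [aR pa /eqP av].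
  have [M [c [MA cI gE]]] := affaut_aword j l; have [MV _] := MA.
  have ws : w *m (refl b *m a) = refl e.1 *m (w *m a).
    by rewrite -(refl_isom wV) isomKV.
  rewrite awordS -(aword_aroot j l) -(arefl_afun _ _ MV gE) -/e ws !gE /afun /=.
  have ab : dot (coroot a) b = dot (w *m a) e.1 / nu a.
    by rewrite -(trmxK w) dot_mulmx trmxK (dotC (coroot a)) dot_coroot dotC.
  rewrite ab -av -!mulmxA -!refl_mul dot_coroot; ring.
have de : d l.+1 = (nu b == v)%:R by rewrite /b (nu_isom (proj1 tA)).
suff : d l.+1 - flips D v w b <= Num.max 0 (- height D v b) by lra.
rewrite le_max de; have [pb|npb] := boolP (pos b).
  by rewrite subr_le0 flips_ge //= /b isomKV.
by rewrite flips_le ?orbT.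
Qed.

End Affine.

(** * Positivity along reduced words *)

Section ReducedWords.
Context {R : realType} {n : nat} (D : rootData R n).
Implicit Types (a b x y : 'cV[R]_n) (w : 'M[R]_n) (e z : affv (R := R) (n := n)).
Local Notation simple := (simple D).
Local Notation asimple := (asimple D).
Local Notation sref i := (arefl (asimple i)).
Local Notation fref i := (fun x : 'cV[R]_n => refl (simple i) *m x).
Local Notation pos := (pos D).
Local Notation affpos := (affpos D).

Lemma seq_word (I : Type) (x0 : I) (t : seq I) :
  [seq nth x0 t k.-1 | k <- index_iota 1 (size t).+1] = t.
Proof.
by rewrite /index_iota subn1 (iotaDl 1 0) -map_comp; exact: mkseq_nth.
Qed.

Lemma areduced_seq j l : areduced D j l ->
  reduced (fun i => sref i) [seq j k | k <- index_iota 1 l.+1].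
Proof.
move=> red; rewrite -[X in reduced _ X]revK; apply: (reduced_rev (srefK D)) => t' e.
rewrite size_rev size_map size_iota subn1 /=.
rewrite -(size_rev t'); apply: (red (fun k => nth (j 0) (rev t') k.-1)) => z.
by rewrite !awordE seq_word revK.
Qed.

Lemma reduced_affpos t i : reduced (fun i => sref i) (rcons t i) ->
  affpos (act (fun i => sref i) t (asimple i)).
Proof.
apply: reduced_pos => //; [exact: srefK | exact: affpos_simple | |].
  exact: affpos_refl.
exact: act_sref_conj.
Qed.

Lemma index_iota_split m k l : (m <= k)%N -> (k < l)%N ->
  index_iota m l = index_iota m k ++ k :: index_iota k.+1 l.
Proof.
move=> mk kl; rewrite /index_iota.
have -> : (l - m = (k - m) + (l - k.+1).+1)%N by lia.
by rewrite iotaD /= subnKC.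
Qed.

Lemma affaut_opp g z : affaut D g -> g (- z.1, - z.2) = (- (g z).1, - (g z).2).
Proof.
by case=> w [c [_ _ gE]]; rewrite !gE /afun /= mulmxN dotNr opprD.
Qed.

Lemma arefl_self e : e.1 \in roots D -> arefl e e = (- e.1, - e.2).
Proof.
move=> eR; rewrite /arefl (coroot_self eR) scaler_nat mulr2n opprD addrA subrr sub0r.
by congr pair; ring.
Qed.

Lemma asimple_inj : injective asimple.
Proof.
move=> i k; rewrite /asimple; case: unliftP => [i' ->|->]; case: unliftP => [k' ->|->] //.
- case=> e; congr (fintype.lift _ _); apply/eqP; move: (rcoef_simple D i' k').
  by rewrite e rcoef_simple eqxx eq_sym; case: eqP => // _ /eqP; rewrite oner_eq0.
- by case=> _ /eqP; rewrite eq_sym oner_eq0.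
- by case=> _ /eqP; rewrite oner_eq0.
Qed.

(** Let t1, j_i, t2 be the letters j_1, ..., j_l in this order.  The root
    alpha^i = t1(alpha_(j_i)) is positive, and so is y = t2^-1(alpha_(j_i)), both
    by the exchange condition.  Conjugation by pi permutes the simple
    reflections, so pi(y) is also given by a reduced word and is positive; and
    b maps alpha^i to - pi(y).  A negative finite part would make both
    alpha^i.2 > 0 and - (alpha^i.1, b) >= 0, whereas their sum is
    - pi(y).2 <= 0. *)
Lemma aroot_pos b pi j l i : inPplus D b -> inPi D pi ->
  atrans b =1 pi \o aword D j l -> areduced D j l -> (0 < i <= l)%N ->
  pos (aroot D j i).1.
Proof.
case/andP=> _ /forallP bdom [[b' [w [_ wW piE]]] piS] bE red /andP [i0 il].
have [wV _] := inW_aut wW.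
have piF : pi =1 afun w (- (w^T *m b')).
  by move=> z; rewrite piE /atrans /afun /= dotNl [in RHS]dotC -dot_mulmx.
have piI : injective pi.
  move=> [x s] [y t]; rewrite !piF /afun /= => -[xy]; rewrite -(isomK wV x) xy isomK //.
  by move/addIr ->.
have [sg sgE] := fin_all_exists piS.
have sgI : injective sg.
  by move=> u v e; apply/asimple_inj/piI; rewrite !sgE e.
have piact t z : pi (act (fun i => sref i) t z) =
    act (fun i => sref i) (map sg t) (pi z).
  by elim: t => //= u t IH; rewrite (arefl_afun _ _ wV piF) sgE IH.
have red0 := areduced_seq red.
rewrite (index_iota_split i0 (il : i < l.+1)%N) map_cat map_cons -cat_rcons in red0.
set t1 := map j _ in red0; set t2 := map j _ in red0.
have gpos : affpos (aroot D j i).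
  rewrite arootE; apply: reduced_affpos.
  exact: (@reduced_infix _ _ _ [::] _ t2).
set y := act (fun i => sref i) (rev t2) (asimple (j i)).
have wordg : aword D j l (aroot D j i) = (- y.1, - y.2).
  rewrite awordE arootE (index_iota_split i0 (il : i < l.+1)%N) map_cat map_cons.
  rewrite -/t1 -/t2 rev_cat rev_cons act_cat act_rcons act_rev; last exact: srefK.
  have [aR _] := asimple_root D (j i); rewrite arefl_self //.
  by rewrite (affaut_opp _ (affaut_act D _)).
have ypos : affpos (pi y).
  rewrite piact sgE; apply: reduced_affpos; rewrite -map_rcons.
  have red2 : reduced (fun i => sref i) (rcons (rev t2) (j i)).
    rewrite -rev_cons; apply: (reduced_rev (srefK D)).
    by apply: (@reduced_infix _ _ _ t1 _ [::]); rewrite cats0 -cat_rcons.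
  move=> t' e; rewrite size_map -(size_map (invF sgI) t'); apply: red2 => z.
  apply: piI; rewrite !piact -e -map_comp; congr (act _ _ _).
  by rewrite -[RHS]map_id; apply: eq_map => u /=; rewrite f_invF.
have : (atrans b (aroot D j i)).2 = - (pi y).2.
  by rewrite bE /= wordg !piF /afun /= dotNr opprD.
case: gpos ypos => -[gR _] g1 [[yR _] y1] /= e; apply/negPn/negP => npos.
have ge0 : 0 <= (pi y).2.
  rewrite -(divfK (nu_neq0 yR) (pi y).2) mulr_ge0 ?(ltW (nu_gt0 yR)) //.
  by apply: le_trans y1; rewrite /chi; case: ifP.
have gt0 : 0 < (aroot D j i).2.
  rewrite -(divfK (nu_neq0 gR) (_).2) mulr_gt0 ?(nu_gt0 gR) //.
  by apply: lt_le_trans g1; rewrite /chi (negbTE npos).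
have db : dominant D b.
  move=> k; have := bdom k; rewrite dot_coroot pmulr_lge0 //.
  by rewrite invr_gt0 (nu_gt0 (simple_root D k)).
have := dominant_pos db (_ : pos (- (aroot D j i).1)).
rewrite posN // => /(_ npos); rewrite dotNr dotC; lra.
Qed.

Lemma frefK i : involutive (fref i).
Proof. by move=> x; rewrite refl_refl ?(root_neq0 (simple_root D i)). Qed.

Lemma big_act j (r : seq nat) x :
  (\big[mulmx/1%:M]_(k <- r) refl (simple (j k))) *m x =
  act (fun i => fref i) [seq j k | k <- r] x.
Proof.
elim: r => [|k r IH]; first by rewrite big_nil mul1mx.
by rewrite big_cons -mulmxA IH.
Qed.

Lemma act_fref_aut t : exists2 w, aut D w & forall x, act (fun i => fref i) t x = w *m x.
Proof.
elim: t => [|i t [w wA wE]].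
  by exists 1%:M => [|x]; [exact: aut1 | rewrite mul1mx].
exists (refl (simple i) *m w) => [|x]; last by rewrite /= wE mulmxA.
by apply: autM wA; apply/aut_refl/simple_root.
Qed.

Lemma wreduced_seq j l : wreduced D j l ->
  reduced (fun i => fref i) [seq j k | k <- index_iota 1 l.+1].
Proof.
move=> red; rewrite -[X in reduced _ X]revK; apply: (reduced_rev frefK) => t' e.
rewrite size_rev size_map size_iota subn1 /=.
rewrite -(size_rev t'); apply: (red (fun k => nth (j 0) (rev t') k.-1)).
by apply: mulmx_inj => x; rewrite !big_act !map_rev seq_word revK.
Qed.

Lemma reduced_posroot t i : reduced (fun i => fref i) (rcons t i) ->
  pos (act (fun i => fref i) t (simple i)).
Proof.
move=> red; suff [] : act (fun i => fref i) t (simple i) \in roots D /\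
  pos (act (fun i => fref i) t (simple i)) by [].
move: red; apply: (@reduced_pos _ _ _ _ (fun x => x \in roots D /\ pos x)).
- exact: frefK.
- by move=> k; split; [exact: simple_root | exact: pos_simple].
- move=> k x [xR px] xk; split; last exact: pos_refl_simple.
  by apply: roots_refl => //; exact: simple_root.
move=> {}t k k' e x; have [w [wV _] wE] := act_fref_aut t.
by rewrite !wE -(refl_isom wV) -wE e.
Qed.

Lemma wreduced_pos j l r i : wreduced D j l -> (0 < r)%N -> (r <= i <= l)%N ->
  pos (act (fun i => fref i) [seq j k | k <- index_iota r i] (simple (j i))).
Proof.
move=> /wreduced_seq red r0 /andP [ri il]; apply: reduced_posroot.
move: red; rewrite (index_iota_split (leq_trans r0 ri) (il : i < l.+1)%N).
rewrite map_cat map_cons -cat_rcons.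
have -> : index_iota 1 i = index_iota 1 r ++ index_iota r i.
  rewrite /index_iota; have -> : (i - 1 = (r - 1) + (i - r))%N by lia.
  by rewrite iotaD subnKC.
by rewrite map_cat rcons_cat -catA => /reduced_infix.
Qed.

End ReducedWords.

(** * Integrality on the weight lattice *)

Section Weights.
Context {R : realType} {n : nat} (D : rootData R n).
Implicit Types (a b x y : 'cV[R]_n) (w : 'M[R]_n).
Local Notation simple := (simple D).
Local Notation pos := (pos D).

Lemma coroot_refl_simple i a : a \in roots D ->
  coroot a = coroot (refl (simple i) *m a) +
             dot (simple i) (coroot a) *: coroot (simple i).
Proof.
move=> aR; have s0 := root_neq0 (simple_root D i).
rewrite (coroot_isom (refl_isometry s0)) refl_mul dot_coroot.
rewrite {2}/coroot scalerA (_ : _ * _ = dot (coroot a) (simple i) / nu (simple i)) ?subrK //.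
by rewrite dotC /nu; have := dot_gt0 s0 => d0; field; rewrite gt_eqF.
Qed.

(** Every coroot is an integral combination of the simple ones: if the positive
    root a is not simple, some simple reflection lowers the sum of its
    coefficients and changes the coroot by an integral multiple of a simple coroot. *)
Lemma int_coroot b : (forall i, dot b (coroot (simple i)) \is a Num.int) ->
  {in roots D, forall a, dot b (coroot a) \is a Num.int}.
Proof.
move=> bI; suff posI N a : \sum_i rcoef simple a i 0 < N%:R -> a \in roots D -> pos a ->
    dot b (coroot a) \is a Num.int.
  have boundP a : exists N, \sum_i rcoef simple a i 0 < N%:R.
    exists (Num.bound `|\sum_i rcoef simple a i 0|).
    exact: le_lt_trans (ler_norm _) (archi_boundP (normr_ge0 _)).
  move=> a aR; have [pa|npa] := boolP (pos a).
    by have [N lt] := boundP a; exact: posI lt aR pa.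
  have [N lt] := boundP (- a); have := posI _ _ lt (rootN aR).
  by rewrite posN // npa corootN dotNr rpredN => /(_ isT).
elim: N a => [|N IH] a lt aR pa.
  have : 0 <= \sum_i rcoef simple a i 0.
    by apply: sumr_ge0 => i _; exact: (forallP pa).
  by rewrite leNgt lt.
have [i ai] : exists i, 0 < dot a (simple i).
  apply/existsP; apply: contraLR (dot_gt0 (root_neq0 aR)) => /existsPn npos.
  rewrite -leNgt -{2}(rcoefK D a) dot_sumr; apply: sumr_le0 => i _.
  by rewrite dotZr mulr_ge0_le0 ?(forallP pa) // leNgt npos.
have [->|ane] := eqVneq a (simple i); first exact: bI.
have sR := simple_root D i.
rewrite (coroot_refl_simple i aR) dotDr dotZr; apply: rpredD; last first.
  by apply: rpredM; [exact: (roots_int aR sR) | exact: bI].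
apply: IH; [|exact: roots_refl|exact: pos_refl_simple].
have /intrP [z zE] : dot a (coroot (simple i)) \is a Num.int by rewrite (roots_int sR aR).
have z1 : 1 <= z%:~R :> R.
  rewrite -[1]/(1%:~R) ler_int -gtz0_ge1 -(ltr_int R) -zE dot_coroot.
  by rewrite divr_gt0 ?(nu_gt0 sR).
apply: le_lt_trans (_ : \sum_k rcoef simple a k 0 - 1 < _); last first.
  by rewrite ltrBlDr natr1.
rewrite [leLHS](bigD1 i) //= [X in _ <= X - 1](bigD1 i) //=.
rewrite refl_mul zE rcoefD rcoefN rcoefZ rcoef_simple eqxx mulr1.
under eq_bigr => k ki do rewrite rcoefD rcoefN rcoefZ rcoef_simple (negbTE ki) mulr0 subr0.
lra.
Qed.

Lemma inP_int b : inP D b -> {in roots D, forall a, dot b (coroot a) \is a Num.int}.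
Proof. by move=> /allP. Qed.

Lemma inP_simple b : (forall i, dot b (coroot (simple i)) \is a Num.int) -> inP D b.
Proof. by move=> /int_coroot h; apply/allP. Qed.

Lemma inP_aut w b : aut D w -> inP D b -> inP D (w *m b).
Proof.
move=> wA bP; have [wV _] := wA; apply/allP => a aR.
by rewrite dot_mulmx -(coroot_isom (proj1 (aut_tr wA))) (inP_int bP) // (aut_root (aut_tr wA)).
Qed.

Lemma inP_root a : a \in roots D -> inP D a.
Proof. by move=> aR; apply/allP => b bR; exact: (roots_int bR aR). Qed.

Lemma inP_scale a c : c \is a Num.int -> inP D a -> inP D (c *: a).
Proof.
by move=> cI aP; apply/allP => b bR; rewrite dotZl rpredM // inP_int.
Qed.

Definition coroot_mx : 'M[R]_n := \matrix_(k, l) coroot (simple k) l 0.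

Lemma coroot_mx_unit : coroot_mx \in unitmx.
Proof.
have -> : coroot_mx =
    diag_mx (\row_i (2 / dot (simple i) (simple i))) *m (simple_mx simple)^T.
  by apply/matrixP => i j; rewrite mul_diag_mx !mxE.
rewrite unitmx_mul unitmx_tr simple_basis andbT unitmxE det_diag unitfE.
apply/prodf_neq0 => i _; rewrite mxE mulf_neq0 ?pnatr_eq0 // invr_neq0 //.
by rewrite gt_eqF // dot_gt0 // (root_neq0 (simple_root D i)).
Qed.

Lemma dot_fweight i k : dot (fweight D i) (coroot (simple k)) = (k == i)%:R.
Proof.
have := congr1 (fun M : 'M[R]_n => M k i) (mulmxV coroot_mx_unit).
rewrite !mxE dotE => <-; apply: eq_bigr => l _.
by rewrite /fweight !mxE mulrC.
Qed.

Lemma inP_fweight i : inP D (fweight D i).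
Proof.
by apply: inP_simple => k; rewrite dot_fweight; case: eqP; rewrite ?rpred0 ?rpred1.
Qed.

Lemma dot_simple_eq0 b : (forall i, dot b (coroot (simple i)) = 0) -> b = 0.
Proof.
move=> b0; rewrite -(mulKmx coroot_mx_unit b) (_ : coroot_mx *m b = 0) ?mulmx0 //.
apply/matrixP => i j; rewrite ord1 !mxE -[RHS](b0 i) dotE.
by apply: eq_bigr => l _; rewrite !mxE mulrC.
Qed.

Lemma fweight_sum b : \sum_i dot b (coroot (simple i)) *: fweight D i = b.
Proof.
apply/eqP; rewrite -subr_eq0; apply/eqP/dot_simple_eq0 => k.
rewrite dotBl dot_suml (bigD1 k) //= big1 => [|i ik].
  by rewrite dotZl dot_fweight eqxx mulr1 addr0 subrr.
by rewrite dotZl dot_fweight eq_sym (negbTE ik) mulr0.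
Qed.

Lemma height_int v b : inP D b -> height D v b \is a Num.int.
Proof.
move=> bP; rewrite /height big_seq_cond; apply: rpred_sum => a /andP [aR _].
by rewrite dotC inP_int //; move: aR; rewrite mem_filter => /andP [].
Qed.

End Weights.

(** * The order of a rational function *)

Section Order.
Context (F : fieldType) {R : realType} {n : nat} (D : rootData R n).
Local Notation N := (nvars D).
Local Notation poly := {mpoly F[N]}.
Local Notation ratfun := (ratfun F D).
Implicit Types (p q : poly) (i : 'I_N) (g h : ratfun) (v : R).

Lemma pord_le i p m : m \in msupp p -> (pord i p <= m i)%N.
Proof.
rewrite /pord; elim: (msupp p) => // m' s IH; rewrite inE big_cons geq_min.
by case/orP => [/eqP ->|/IH ->]; rewrite ?leqnn ?orbT.
Qed.

Lemma pord_ge i p k : p != 0 -> {in msupp p, forall m : 'X_{1..N}, (k <= m i)%N} ->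
  (k <= pord i p)%N.
Proof.
move=> p0 h; rewrite /pord big_seq.
elim/big_rec: _ => [|m x mp kx]; last by rewrite leq_min h.
case e : (msupp p) => [|m s]; first by rewrite -msupp_eq0 e in p0.
have mp : m \in msupp p by rewrite e mem_head.
apply: leq_trans (h m mp) _; apply: leq_trans (ltnW (msize_mdeg_lt mp)).
by rewrite mdegE (bigD1 i) //= leq_addr.
Qed.

(** The initial form of p for the degree in the variable i. *)
Definition pinit i p : poly :=
  \sum_(m <- msupp p | m i == pord i p) p@_m *: 'X_[m].

Lemma mcoeff_pinit i p m : (pinit i p)@_m = if m i == pord i p then p@_m else 0.
Proof.
rewrite /pinit raddf_sum /=; case: ifP => mi.
  have [mp|mp] := boolP (m \in msupp p).
    rewrite big_mkcond (bigD1_seq m) ?msupp_uniq //= mi mcoeffZ mcoeffX eqxx mulr1.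
    rewrite big1 ?addr0 // => m' ne; case: ifP => // _.
    by rewrite mcoeffZ mcoeffX (negbTE ne) mulr0.
  rewrite big1_seq ?memN_msupp_eq0 // => m' /andP [_ m'p].
  rewrite mcoeffZ mcoeffX; case: eqP => e; last by rewrite mulr0.
  by rewrite e (negbTE mp) in m'p.
rewrite big1 // => m' m'i; rewrite mcoeffZ mcoeffX.
by case: eqP => e; rewrite ?mulr0 //; rewrite -e m'i in mi.
Qed.

Lemma pinit_neq0 i p : p != 0 -> pinit i p != 0.
Proof.
move=> p0.
have [h|] := boolP (all (fun m : 'X_{1..N} => (pord i p < m i)%N) (msupp p)).
  by have := pord_ge p0 (allP h); rewrite ltnn.
case/allPn => m mp; rewrite -leqNgt => mi.
have {mi} mi : m i == pord i p by rewrite eqn_leq mi pord_le.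
apply/eqP => e; have := mcoeff_pinit i p m.
by rewrite e mcoeff0 mi => p0m; rewrite mcoeff_msupp -p0m eqxx in mp.
Qed.

(** The product of the initial forms is nonzero, and it is the part of degree
    pord i p + pord i q of the product. *)
Lemma pordM i p q : p != 0 -> q != 0 -> pord i (p * q) = (pord i p + pord i q)%N.
Proof.
move=> p0 q0; have pq0 : p * q != 0 by rewrite mulf_neq0.
have suppM p' q' a b : {in msupp p', forall m : 'X_{1..N}, (a <= m i)%N} ->
    {in msupp q', forall m : 'X_{1..N}, (b <= m i)%N} ->
    {in msupp (p' * q'), forall m : 'X_{1..N}, (a + b <= m i)%N}.
  move=> ha hb m /msuppM_le /allpairsP [[m1 m2] /= [m1p m2q ->]].
  by rewrite mnmDE leq_add ?ha ?hb.
have ge : (pord i p + pord i q <= pord i (p * q)%R)%N.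
  by apply: pord_ge => //; apply: suppM => m; exact: pord_le.
apply/eqP; rewrite eqn_leq ge andbT {ge}.
have [m m0] : exists m, m \in msupp (pinit i p * pinit i q).
  have := mulf_neq0 (pinit_neq0 i p0) (pinit_neq0 i q0); rewrite -msupp_eq0.
  by case: (msupp _) => // m s _; exists m; rewrite mem_head.
have suppR p' m' : m' \in msupp (p' - pinit i p') -> (pord i p' < m' i)%N.
  rewrite mcoeff_msupp mcoeffB mcoeff_pinit; case: ifP => mi.
    by rewrite subrr eqxx.
  by rewrite subr0 -mcoeff_msupp => mp; rewrite ltn_neqAle eq_sym mi pord_le.
have suppI p' m' : m' \in msupp (pinit i p') -> m' i = pord i p'.
  by rewrite mcoeff_msupp mcoeff_pinit; case: ifP => [/eqP -> //|]; rewrite eqxx.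
have mi : m i = (pord i p + pord i q)%N.
  move: m0 => /msuppM_le /allpairsP [[m1 m2] /= [/suppI m1p /suppI m2q ->]].
  by rewrite mnmDE m1p m2q.
rewrite -mi; apply: pord_le; rewrite mcoeff_msupp.
have -> : p * q = pinit i p * pinit i q + ((p - pinit i p) * q +
    pinit i p * (q - pinit i q)) by ring.
rewrite mcoeffD [X in _ + X](_ : _ = 0) ?addr0 -?mcoeff_msupp //.
apply: memN_msupp_eq0; apply/negP => /msuppD_le; rewrite mem_cat => /orP [] mm.
  have : ((pord i p).+1 + pord i q <= m i)%N.
    by apply: suppM mm => m'; [exact: suppR | exact: pord_le].
  by rewrite mi ltnn.
have : (pord i p + (pord i q).+1 <= m i)%N.
  by apply: suppM mm => m'; [move=> /suppI -> | exact: suppR].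
by rewrite mi addnS ltnn.
Qed.

Lemma pordX i m : pord i ('X_[m] : poly) = m i.
Proof.
apply/eqP; rewrite eqn_leq pord_le ?msuppX ?mem_head //=.
apply: pord_ge; first by rewrite -msupp_eq0 msuppX.
by move=> m'; rewrite msuppX inE => /eqP ->.
Qed.

Lemma pord_binomial i m1 m2 : m1 != m2 ->
  pord i ('X_[m1] - 'X_[m2] : poly) = minn (m1 i) (m2 i) /\ 'X_[m1] - 'X_[m2] != 0 :> poly.
Proof.
move=> m12; have c1 : ('X_[m1] - 'X_[m2] : poly)@_m1 = 1.
  by rewrite mcoeffB !mcoeffX eqxx eq_sym (negbTE m12) subr0.
have c2 : ('X_[m1] - 'X_[m2] : poly)@_m2 = -1.
  by rewrite mcoeffB !mcoeffX eqxx (negbTE m12) sub0r.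
have nz : 'X_[m1] - 'X_[m2] != 0 :> poly.
  by apply/eqP => e; move: c1; rewrite e mcoeff0 => /eqP; rewrite eq_sym oner_eq0.
split=> //; apply/eqP; rewrite eqn_leq leq_min !pord_le ?pord_ge //.
- move=> m /msuppB_le; rewrite mem_cat !msuppX !inE => /orP [] /eqP ->.
    exact: geq_minl.
  exact: geq_minr.
- by rewrite mcoeff_msupp c2 oppr_eq0 oner_eq0.
by rewrite mcoeff_msupp c1 oner_eq0.
Qed.

Lemma ratfunE g : g = FracField.tofrac (frac (repr g)).1 /
                      FracField.tofrac (frac (repr g)).2.
Proof.
rewrite -{1}[g]reprK; set x := repr g; unlock FracField.tofrac.
rewrite -[X in _ = _ * X]FracField.pi_inv -[RHS]FracField.pi_mul.
rewrite /FracField.mulf /FracField.invf !numden_Ratio ?oner_neq0 ?denom_ratioP //.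
by rewrite mulr1 mul1r Ratio_numden.
Qed.

(** The order does not depend on the chosen representative of the fraction. *)
Lemma tord_frac v p q : p != 0 -> q != 0 ->
  tord v (FracField.tofrac p / FracField.tofrac q : ratfun) =
  Some (((pord (tidx D v) p)%:R - (pord (tidx D v) q)%:R) / 2).
Proof.
move=> p0 q0; set g := _ / _; have g0 : g != 0.
  by rewrite mulf_neq0 ?invr_eq0 ?tofrac_eq0.
rewrite /tord (negbTE g0); set x := frac _; congr (Some (_ / _)).
have d0 : x.2 != 0 by rewrite denom_ratioP.
have gE := ratfunE g; rewrite -/x in gE.
have n0 : x.1 != 0.
  by apply: contraNneq g0 => e; rewrite gE e tofrac0 mul0r.
have : x.1 * q = p * x.2.
  apply/eqP; rewrite -tofrac_eq !tofracM; apply/eqP.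
  have : g * FracField.tofrac q = FracField.tofrac p by rewrite /g divfK ?tofrac_eq0.
  by rewrite {1}gE => <-; rewrite [RHS]mulrAC divfK ?tofrac_eq0.
move/(congr1 (pord (tidx D v))); rewrite !pordM //.
move/(congr1 (fun k => k%:R : rat)); rewrite !natrD; lra.
Qed.

Lemma tordP g : g != 0 -> exists p q, [/\ p != 0, q != 0 &
  g = FracField.tofrac p / FracField.tofrac q].
Proof.
move=> g0; exists (frac (repr g)).1, (frac (repr g)).2.
split; [|exact: denom_ratioP|exact: ratfunE].
by apply: contraNneq g0 => e; rewrite (ratfunE g) e tofrac0 mul0r.
Qed.

Lemma tord_neq0 v g x : tord v g = Some x -> g != 0.
Proof. by rewrite /tord; case: eqP. Qed.

Lemma tordM v g h x y : tord v g = Some x -> tord v h = Some y ->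
  tord v (g * h) = Some (x + y).
Proof.
move=> gx hy; have [p [q [p0 q0 gE]]] := tordP (tord_neq0 gx).
have [p' [q' [p'0 q'0 hE]]] := tordP (tord_neq0 hy).
move: gx hy; rewrite gE hE !tord_frac // => -[<-] [<-].
rewrite mulrACA -invfM -!tofracM tord_frac ?mulf_neq0 // !pordM // !natrD.
by congr Some; lra.
Qed.

Lemma tordV v g x : tord v g = Some x -> tord v g^-1 = Some (- x).
Proof.
move=> gx; have [p [q [p0 q0 gE]]] := tordP (tord_neq0 gx).
move: gx; rewrite gE tord_frac // => -[<-].
by rewrite invf_div tord_frac //; congr Some; lra.
Qed.

End Order.

(** * Laurent monomials *)

Section Monomials.
Context (F : fieldType) {R : realType} {n : nat} (D : rootData R n).
Local Notation N := (nvars D).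
Local Notation poly := {mpoly F[N]}.
Local Notation ratfun := (ratfun F D).
Local Notation tofrac := (@FracField.tofrac {mpoly F[nvars D]}).
Local Notation gen := (gen F).
Implicit Types (p q : poly) (i : 'I_N) (g h : ratfun) (v : R) (e : 'rV[int]_N).

Definition mon e : ratfun := \prod_(i < N) gen i ^ e 0 i.

Lemma gen_neq0 i : gen i != 0.
Proof. by rewrite tofrac_eq0 -msupp_eq0 msuppX. Qed.

Lemma gen_unit i : gen i \is a GRing.unit.
Proof. by rewrite unitfE gen_neq0. Qed.

Lemma mon_neq0 e : mon e != 0.
Proof. by apply/prodf_neq0 => i _; rewrite expfz_neq0 ?gen_neq0. Qed.

Lemma mon0 : mon 0 = 1.
Proof. by rewrite /mon big1 // => i _; rewrite mxE expr0z. Qed.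

Lemma monD e1 e2 : mon (e1 + e2) = mon e1 * mon e2.
Proof.
by rewrite /mon -big_split; apply: eq_bigr => i _; rewrite mxE expfzDr ?gen_neq0.
Qed.

Lemma monN e : mon (- e) = (mon e)^-1.
Proof.
by apply: (mulIf (mon_neq0 e)); rewrite -monD addNr mon0 mulVf ?mon_neq0.
Qed.

Lemma mon_sum (I : Type) (r : seq I) (P : pred I) (E : I -> 'rV[int]_N) :
  mon (\sum_(i <- r | P i) E i) = \prod_(i <- r | P i) mon (E i).
Proof.
by elim/big_rec2: _ => [|i x y _ <-]; [exact: mon0 | rewrite monD].
Qed.

Lemma mon_delta (z : int) i : mon (z *: delta_mx 0 i) = gen i ^ z.
Proof.
rewrite /mon (bigD1 i) //= !mxE !eqxx mulr1 big1 ?mulr1 // => k ki.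
by rewrite !mxE (negbTE ki) andbF mulr0 expr0z.
Qed.

Lemma monZ (z : int) e : mon (z *: e) = mon e ^ z.
Proof.
rewrite /mon (big_morph (fun x : ratfun => x ^ z) (fun x y => expfzMl x y z) (exp1rz _ z)).
by apply: eq_bigr => i _; rewrite mxE mulrC exprz_exp.
Qed.

Definition mexp (m : 'X_{1..N}) : 'rV[int]_N := \row_i (m i)%:Z.

Lemma mon_mexp m : mon (mexp m) = tofrac 'X_[m].
Proof.
rewrite mpolyXE_id rmorph_prod; apply: eq_bigr => i _.
by rewrite mxE; exact/esym/tofracXn.
Qed.

Lemma mexp_split e : exists m1 m2, e = mexp m1 - mexp m2.
Proof.
exists [multinom absz (Num.max (e 0 i) 0)%R | i < N],
       [multinom absz (Num.max (- e 0 i) 0)%R | i < N].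
by apply/rowP => i; rewrite !mxE !mnmE; lia.
Qed.

Lemma tord_mon v e : tord v (mon e) = Some ((e 0 (tidx D v))%:~R / 2).
Proof.
have [m1 [m2 eE]] := mexp_split e; rewrite eE monD monN !mon_mexp tord_frac.
- by rewrite !pordX !mxE intrD rmorphN.
- by rewrite -msupp_eq0 msuppX.
by rewrite -msupp_eq0 msuppX.
Qed.

(** Two distinct monomials do not cancel, whatever their exponents at t_v. *)
Lemma tord_mon1 v e : e != 0 ->
  tord v (mon e - 1) = Some ((Num.min (e 0 (tidx D v)) 0)%:~R / 2).
Proof.
have [m1 [m2 eE]] := mexp_split e; rewrite eE => e0.
have X0 : 'X_[m2] != 0 :> poly by rewrite -msupp_eq0 msuppX.
have m12 : m1 != m2 by apply: contraNneq e0 => ->; rewrite subrr.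
rewrite monD monN !mon_mexp -[X in _ - X](divff (_ : tofrac 'X_[m2] != 0)) ?tofrac_eq0 //.
have [pE p0] := @pord_binomial F _ _ D (tidx D v) _ _ m12.
rewrite -mulrBl -tofracB tord_frac // pE pordX !mxE; congr Some; congr (_ / _).
rewrite (_ : Num.min _ _ = (minn (m1 (tidx D v)) (m2 (tidx D v)))%:Z
                          - (m2 (tidx D v))%:Z) ?rmorphB //; lia.
Qed.

(** Multiplying by a common denominator, one is reduced to distinct monomials. *)
Lemma mon_free p (A : 'X_{1..N} -> 'rV[int]_N) : injective A -> p != 0 ->
  \sum_(m <- msupp p) tofrac (p@_m)%:MP * mon (A m) != 0.
Proof.
move=> Ainj p0.
pose B : 'X_{1..N} := [multinom (\sum_(m <- msupp p) absz (A m 0 i)%R)%N | i < N].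
pose C m : 'X_{1..N} := [multinom absz (A m 0 i + (B i)%:Z)%R | i < N].
have CE m : m \in msupp p -> mexp (C m) = A m + mexp B.
  move=> mp; apply/rowP => i; rewrite !mxE mnmE gez0_abs //.
  have : (absz (A m 0 i)%R <= B i)%N.
    by rewrite mnmE (big_rem m) //= leq_addr.
  lia.
set S := (X in X != 0).
have SE : S * mon (mexp B) = tofrac (\sum_(m <- msupp p) p@_m *: 'X_[C m]).
  rewrite mulr_suml rmorph_sum /= big_seq [RHS]big_seq; apply: eq_bigr => m mp.
  by rewrite -mulrA -monD -CE // mon_mexp -tofracM mul_mpolyC.
apply/eqP => S0; move: SE; rewrite S0 mul0r => /esym /eqP; rewrite tofrac_eq0.
apply/negP; have [m mp] : exists m, m \in msupp p.
  move: p0; rewrite -msupp_eq0; case: (msupp p) => // m s _; exists m.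
  by rewrite mem_head.
apply/eqP => /(congr1 (mcoeff (C m))); rewrite mcoeff0 raddf_sum /=.
rewrite (bigD1_seq m) ?msupp_uniq //= mcoeffZ mcoeffX eqxx mulr1.
rewrite big1_seq ?addr0 => [pm|m' /andP [ne m'p]].
  by move: mp; rewrite mcoeff_msupp pm eqxx.
rewrite mcoeffZ mcoeffX; case: eqP => [e|]; last by rewrite mulr0.
case/eqP: ne; apply: Ainj; apply: (addIr (mexp B)).
by rewrite -!CE // e.
Qed.

End Monomials.

(** * Substitution in rational functions *)

Section Substitution.
Context (F : fieldType) {R : realType} {n : nat} (D : rootData R n).
Local Notation N := (nvars D).
Local Notation poly := {mpoly F[N]}.
Local Notation ratfun := (ratfun F D).
Local Notation tofrac := (@FracField.tofrac {mpoly F[nvars D]}).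
Variable y : 'I_n -> ratfun.

Definition subst_var (i : 'I_N) : ratfun :=
  match split i with inl i' => y i' | inr _ => gen F i end.

Definition evalX : poly -> ratfun := mmap (tofrac \o @mpolyC N F) subst_var.

(** An algebraically independent substitution kills no denominator; it can then be
    computed on any representative of a fraction. *)
Hypothesis evalX_eq0 : forall p, evalX p = 0 -> p = 0.

Lemma substX_frac p q : q != 0 -> substX y (tofrac p / tofrac q) = evalX p / evalX q.
Proof.
move=> q0; set g := _ / _; rewrite /substX -/subst_var.
rewrite -[LHS]/(evalX (frac (repr g)).1 / evalX (frac (repr g)).2).
have d0 : (frac (repr g)).2 != 0 by exact: denom_ratioP.
have ev0 p' : p' != 0 -> evalX p' != 0.
  by apply: contraNneq => /evalX_eq0 ->.
have e : (frac (repr g)).1 * q = p * (frac (repr g)).2.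
  apply/eqP; rewrite -tofrac_eq !tofracM; apply/eqP.
  have : g * tofrac q = tofrac p by rewrite /g divfK ?tofrac_eq0.
  by rewrite {1}(ratfunE g) => <-; rewrite [RHS]mulrAC divfK ?tofrac_eq0.
apply/eqP; rewrite eqr_div ?ev0 //; apply/eqP.
by rewrite -[LHS]rmorphM e rmorphM.
Qed.

Lemma substX_is_zmod_morphism : zmod_morphism (substX y).
Proof.
move=> g h; rewrite (ratfunE g) (ratfunE h).
move: (frac (repr g)) (frac (repr h)) (denom_ratioP (repr g)) (denom_ratioP (repr h)).
move=> [a b] [c d] /= b0 d0.
have ev0 p' : p' != 0 -> evalX p' != 0.
  by apply: contraNneq => /evalX_eq0 ->.
rewrite -mulNr -tofracN addf_div ?tofrac_eq0 // -!tofracM -tofracD.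
rewrite !substX_frac ?mulf_neq0 // -mulNr addf_div ?ev0 //.
by rewrite /evalX rmorphD !rmorphM rmorphN.
Qed.

Lemma substX_is_monoid_morphism : monoid_morphism (substX y).
Proof.
split=> [|g h].
  rewrite -[1](divff (_ : tofrac 1 != 0)) ?substX_frac ?oner_neq0 ?tofrac_eq0 ?oner_neq0 //.
  by rewrite /evalX rmorph1 divff ?oner_neq0 // tofrac1 invr1 mulr1.
rewrite (ratfunE g) (ratfunE h).
move: (frac (repr g)) (frac (repr h)) (denom_ratioP (repr g)) (denom_ratioP (repr h)).
move=> [a b] [c d] /= b0 d0.
rewrite mulf_div -!tofracM !substX_frac ?mulf_neq0 //.
by rewrite /evalX !rmorphM mulf_div.
Qed.

End Substitution.

(** * Orders of the images of f and g *)

Section Kappa.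
Context (F : fieldType) {R : realType} {n : nat} (D : rootData R n) (m : nat).
Local Notation N := (nvars D).
Local Notation poly := {mpoly F[N]}.
Local Notation ratfun := (ratfun F D).
Local Notation tofrac := (@FracField.tofrac {mpoly F[nvars D]}).
Local Notation gen := (@Defs.gen F R n D).
Local Notation mon := (mon F).
Local Notation simple := (simple D).
Local Notation pos := (pos D).
Local Notation delta i := (delta_mx 0 i : 'rV[int]_N).
Implicit Types (a b : 'cV[R]_n) (w : 'M[R]_n) (v : R) (e : affv (R := R) (n := n)).

(** The exponents xexp, rexp and kexp of the Laurent monomials X_b, q^(rho_k, b)
    and q^-(rho_k, b) X_b; they are additive in b on the weight lattice. *)
Definition xexp b : 'rV[int]_N :=
  \sum_(i < n) Num.floor (dot b (coroot (simple i))) *: delta (Xidx D i).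

Definition rexp b : 'rV[int]_N :=
  \sum_(v <- nuR D) Num.floor (2 * dot (rhov D v) b) *: delta (tidx D v).

Definition kexp b := xexp b - rexp b.

Lemma X_mon b : X F D b = mon (xexp b).
Proof. by rewrite /xexp mon_sum; apply: eq_bigr => i _; rewrite mon_delta. Qed.

Lemma qrho_mon b : qrho F D b = mon (rexp b).
Proof. by rewrite /rexp mon_sum; apply: eq_bigr => i _; rewrite mon_delta. Qed.

Lemma floorD_int (x y : R) : x \is a Num.int -> y \is a Num.int ->
  Num.floor (x + y) = Num.floor x + Num.floor y.
Proof.
by move=> xI yI; apply: (@intr_inj R); rewrite rmorphD /= !floorK // rpredD.
Qed.

Lemma floorZ_int (z : int) (x : R) : x \is a Num.int ->
  Num.floor (z%:~R * x) = z * Num.floor x.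
Proof.
move=> xI; apply: (@intr_inj R); rewrite rmorphM /= !floorK // rpredM //.
exact: intr_int.
Qed.

Lemma kexpD a b : inP D a -> inP D b -> kexp (a + b) = kexp a + kexp b.
Proof.
move=> aP bP; rewrite /kexp addrACA -opprD; congr (_ - _); rewrite -big_split /=.
  apply: eq_bigr => i _; rewrite dotDl floorD_int ?scalerDl //.
    exact: (inP_int aP (simple_root D i)).
  exact: (inP_int bP (simple_root D i)).
apply: eq_bigr => v _.
by rewrite dotDr mulrDr -!heightE floorD_int ?scalerDl ?height_int.
Qed.

Lemma kexpZ (z : int) a : inP D a -> kexp (z%:~R *: a) = z *: kexp a.
Proof.
move=> aP; rewrite /kexp scalerBr !scaler_sumr; congr (_ - _).
  apply: eq_bigr => i _; rewrite dotZl floorZ_int ?scalerA //.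
  exact: (inP_int aP (simple_root D i)).
by apply: eq_bigr => v _; rewrite dotZr mulrCA -heightE floorZ_int ?scalerA ?height_int.
Qed.

Lemma inP_sum (z : 'I_n -> int) (b : 'I_n -> 'cV[R]_n) (r : seq 'I_n) :
  (forall i, inP D (b i)) -> inP D (\sum_(i <- r) (z i)%:~R *: b i).
Proof.
move=> bP; apply/allP => a aR; rewrite dot_suml; apply: rpred_sum => i _.
by rewrite dotZl rpredM ?intr_int ?(inP_int (bP i) aR).
Qed.

Lemma kexp_sum (z : 'I_n -> int) (b : 'I_n -> 'cV[R]_n) : (forall i, inP D (b i)) ->
  kexp (\sum_i (z i)%:~R *: b i) = \sum_i z i *: kexp (b i).
Proof.
move=> bP; elim: (index_enum _) => [|i r IH].
  rewrite !big_nil -(scale0r 0) -[0 : R]/(0%:~R) kexpZ ?scale0r //.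
  by apply/allP => a _; rewrite dot0l rpred0.
by rewrite !big_cons kexpD ?inP_sum ?inP_scale ?intr_int // kexpZ // IH.
Qed.

Lemma xexp_X b k : xexp b 0 (Xidx D k) = Num.floor (dot b (coroot (simple k))).
Proof.
rewrite summxE (bigD1 k) //= !mxE !eqxx mulr1 big1 ?addr0 // => i ik.
by rewrite !mxE /Xidx eq_lshift eq_sym (negbTE ik) andbF mulr0.
Qed.

Lemma xexp_r b k : xexp b 0 (rshift n k) = 0.
Proof. by rewrite summxE big1 // => i _; rewrite !mxE /Xidx eq_rlshift andbF mulr0. Qed.

Lemma rexp_X b k : rexp b 0 (Xidx D k) = 0.
Proof. by rewrite summxE big1 // => i _; rewrite !mxE /Xidx eq_lrshift andbF mulr0. Qed.

Lemma tidx_inj v v' : v \in nuR D -> v' \in nuR D -> (tidx D v == tidx D v') = (v == v').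
Proof.
move=> vR v'R; rewrite /tidx eq_rshift -val_eqE /= !inordK ?ltnS ?index_mem //.
by rewrite eqSS; apply/eqP/eqP => [/index_inj ->|->].
Qed.

Lemma rexp_t b v : v \in nuR D -> rexp b 0 (tidx D v) = Num.floor (height D v b).
Proof.
move=> vR; rewrite heightE summxE (bigD1_seq v) ?undup_uniq //= !mxE !eqxx mulr1.
rewrite big1_seq ?addr0 // => v' /andP [ne v'R].
by rewrite !mxE tidx_inj // eq_sym (negbTE ne) andbF mulr0.
Qed.

Lemma kexp_X b k : kexp b 0 (Xidx D k) = Num.floor (dot b (coroot (simple k))).
Proof. by rewrite !mxE xexp_X rexp_X subr0. Qed.

Lemma kexp_t b v : v \in nuR D -> kexp b 0 (tidx D v) = - Num.floor (height D v b).
Proof. by move=> vR; rewrite !mxE xexp_r rexp_t // sub0r. Qed.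

Section Morphism.
Variable w : 'M[R]_n.
Hypothesis wA : aut D w.

Let y i := (qrho F D (invmx w *m fweight D i))^-1 * X F D (invmx w *m fweight D i).

Definition kvar (i : 'I_N) : 'rV[int]_N :=
  match split i with inl k => kexp (w^T *m fweight D k) | inr _ => delta i end.

Lemma subst_kvar i : subst_var y i = mon (kvar i).
Proof.
rewrite /subst_var /kvar; case: (split i) => [k|_].
  by rewrite /y (isom_inv (proj1 wA)) qrho_mon X_mon -monN -monD addrC.
by rewrite -[delta i]scale1r mon_delta expr1z.
Qed.

Definition klin (mm : 'X_{1..N}) : 'rV[int]_N := \sum_i (mm i)%:Z *: kvar i.

Lemma kvar_X k : kvar (Xidx D k) = kexp (w^T *m fweight D k).
Proof. by rewrite /kvar /Xidx -[lshift _ k]/(unsplit (inl k)) unsplitK. Qed.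

Lemma kvar_r k : kvar (rshift n k) = delta (rshift n k).
Proof. by rewrite /kvar -[rshift n k]/(unsplit (inr k)) unsplitK. Qed.

(** The coordinates of klin mm at the X variables are those of a vector that
    determines the exponents of mm at these variables, as w is invertible; the
    other variables are fixed. *)
Lemma klin_inj : injective klin.
Proof.
move=> m1 m2 e12; have [wV _] := wA; have tA := aut_tr wA.
have wP k : inP D (w^T *m fweight D k) by apply: inP_aut tA _; exact: inP_fweight.
have klinE mm : klin mm = kexp (\sum_k ((mm (lshift _ k))%:Z)%:~R *: (w^T *m fweight D k))
    + \sum_k (mm (rshift n k))%:Z *: delta (rshift n k).
  rewrite /klin big_split_ord kexp_sum //=; congr (_ + _).
    by apply: eq_bigr => k _; rewrite kvar_X.
  by apply: eq_bigr => k _; rewrite kvar_r.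
pose b (mm : 'X_{1..N}) := \sum_k ((mm (lshift _ k))%:Z)%:~R *: (w^T *m fweight D k).
have bP mm : inP D (b mm) by exact: inP_sum.
have b12 : b m1 = b m2.
  apply/eqP; rewrite -subr_eq0; apply/eqP/(@dot_simple_eq0 _ _ D) => k.
  have bI mm : dot (b mm) (coroot (simple k)) \is a Num.int.
    exact: (inP_int (bP mm) (simple_root D k)).
  have r0 (mm : 'X_{1..N}) :
      (\sum_k (mm (rshift n k))%:Z *: delta (rshift n k)) 0 (Xidx D k) = 0.
    by rewrite summxE big1 // => i _; rewrite !mxE /Xidx eq_lrshift andbF mulr0.
  have := congr1 (fun e : 'rV[int]_N => e 0 (Xidx D k)) e12.
  rewrite !klinE mxE [in RHS]mxE !r0 !addr0 !kexp_X dotBl => e.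
  by rewrite -[dot (b m1) _]floorK // -[dot (b m2) _]floorK // e subrr.
have wbE mm : w *m b mm = \sum_k ((mm (lshift _ k))%:Z)%:~R *: fweight D k.
  by rewrite mulmx_sumr; apply: eq_bigr => i _; rewrite -scalemxAr (isomKV wV).
have wbk mm k : dot (w *m b mm) (coroot (simple k)) = (mm (lshift _ k))%:R.
  rewrite wbE dot_suml (bigD1 k) //= big1 => [|i ik].
    by rewrite dotZl dot_fweight eqxx mulr1 addr0.
  by rewrite dotZl dot_fweight eq_sym (negbTE ik) mulr0.
apply/mnmP => i; rewrite -(splitK i); case: (split i) => k.
  by apply/eqP; rewrite -(eqr_nat R) -!wbk b12.
have := congr1 (fun e : 'rV[int]_N => e 0 (rshift n k)) e12.
rewrite !klinE -/(b m1) -/(b m2) b12 mxE [in RHS]mxE => /addrI.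
have rk (mm : 'X_{1..N}) : (\sum_k (mm (rshift n k))%:Z *: delta (rshift n k)) 0 (rshift n k)
    = (mm (rshift n k))%:Z.
  rewrite summxE (bigD1 k) //= !mxE !eqxx mulr1 big1 ?addr0 // => i' ik.
  by rewrite !mxE eq_rshift eq_sym (negbTE ik) andbF mulr0.
by rewrite !rk => -[].
Qed.

Lemma evalX_kappa_eq0 p : evalX y p = 0 -> p = 0.
Proof.
move=> ep; apply/eqP; apply/negPn/negP => p0.
have := mon_free klin_inj p0.
suff -> : \sum_(mm <- msupp p) tofrac (p@_mm)%:MP * mon (klin mm) = evalX y p.
  by rewrite ep eqxx.
apply: eq_bigr => mm _; congr (_ * _).
rewrite /klin mon_sum; apply: eq_bigr => i _.
by rewrite monZ subst_kvar.
Qed.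

Lemma kappaX_zmod_morphism : zmod_morphism (kappaX w : ratfun -> ratfun).
Proof. exact: substX_is_zmod_morphism evalX_kappa_eq0. Qed.

Lemma kappaX_monoid_morphism : monoid_morphism (kappaX w : ratfun -> ratfun).
Proof. exact: substX_is_monoid_morphism evalX_kappa_eq0. Qed.

Definition kmorph : {rmorphism ratfun -> ratfun} :=
  HB.pack (kappaX w : ratfun -> ratfun)
    (GRing.isZmodMorphism.Build ratfun ratfun (kappaX w) kappaX_zmod_morphism)
    (GRing.isMonoidMorphism.Build ratfun ratfun (kappaX w) kappaX_monoid_morphism).

Lemma kappaX_gen i : kappaX w (gen i) = mon (kvar i).
Proof.
transitivity (substX y (tofrac 'X_i / tofrac 1)); first by rewrite tofrac1 divr1.
rewrite (substX_frac evalX_kappa_eq0) ?oner_neq0 // -subst_kvar.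
by rewrite /evalX mmapX mmap1U rmorph1 invr1 mulr1.
Qed.

Lemma kappaX_X b : inP D b -> kappaX w (X F D b) = mon (kexp (w^T *m b)).
Proof.
move=> bP; rewrite -[LHS]/(kmorph _) rmorph_prod.
rewrite -{2}(fweight_sum D b) mulmx_sumr.
have -> : \sum_i w^T *m (dot b (coroot (simple i)) *: fweight D i) =
    \sum_i (Num.floor (dot b (coroot (simple i))))%:~R *: (w^T *m fweight D i).
  apply: eq_bigr => i _; rewrite floorK ?scalemxAr //.
  exact: (inP_int bP (simple_root D i)).
rewrite kexp_sum => [|i]; last by apply: inP_aut (aut_tr wA) _; exact: inP_fweight.
rewrite mon_sum; apply: eq_bigr => i _.
by rewrite monZ -kvar_X -kappaX_gen; apply: (rmorphXz kmorph); exact: gen_unit.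
Qed.

(** The exponent of the image of X_e^-1. *)
Definition uexp e : 'rV[int]_N :=
  - (Num.floor (m%:R * e.2) *: delta (qidx D) + kexp (w^T *m e.1)).

(** The exponent of t_v, the variable being t_v^(1/2). *)
Definition texp v : 'rV[int]_N := 2 *: delta (tidx D v).

Lemma kappaX_genr k : kappaX w (gen (rshift n k)) = gen (rshift n k).
Proof. by rewrite kappaX_gen kvar_r -[delta _]scale1r mon_delta expr1z. Qed.

Lemma kappaX_Xaff e : inP D e.1 -> kappaX w (Xaff F D m e)^-1 = mon (uexp e).
Proof.
move=> eP; rewrite -[LHS]/(kmorph _) fmorphV rmorphM /=.
rewrite kappaX_X // /qpow -[kappaX w (_ ^ _)]/(kmorph _).
rewrite (rmorphXz kmorph) ?gen_unit //= kappaX_genr.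
by rewrite /uexp monN (monD _ (_ *: _)) mon_delta.
Qed.

Lemma kappaX_tpar v : kappaX w (tpar F D v) = mon (texp v).
Proof.
rewrite -[LHS]/(kmorph _) rmorphXn /= kappaX_genr.
by rewrite /texp mon_delta.
Qed.

Lemma kappaX_faff e : inP D e.1 ->
  kappaX w (faff F D m e) = (mon (texp (nu e.1) + uexp e) - 1) / (mon (uexp e) - 1).
Proof.
move=> eP; rewrite -[LHS]/(kmorph _) fmorph_div !rmorphB rmorphM rmorph1 /=.
by rewrite kappaX_tpar kappaX_Xaff // -monD.
Qed.

Lemma kappaX_gaff e : inP D e.1 ->
  kappaX w (gaff F D m e) = (mon (texp (nu e.1)) - 1) / (1 - mon (uexp e)).
Proof.
move=> eP; rewrite -[LHS]/(kmorph _) fmorph_div !rmorphB rmorph1 /=.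
by rewrite kappaX_tpar kappaX_Xaff.
Qed.

Lemma texp_X v k : texp v 0 (Xidx D k) = 0.
Proof. by rewrite !mxE /Xidx eq_lrshift andbF mulr0. Qed.

Lemma uexp_X e k :
  uexp e 0 (Xidx D k) = - Num.floor (dot (w^T *m e.1) (coroot (simple k))).
Proof. by rewrite 2!mxE kexp_X !mxE /Xidx eq_lrshift andbF mulr0 add0r. Qed.

Lemma texp_t v v' : v \in nuR D -> v' \in nuR D ->
  texp v' 0 (tidx D v) = if v' == v then 2 else 0.
Proof. by move=> vR v'R; rewrite /texp !mxE eqxx tidx_inj // eq_sym; case: (v' == v). Qed.

Lemma uexp_t e v : v \in nuR D ->
  uexp e 0 (tidx D v) = Num.floor (height D v (w^T *m e.1)).
Proof.
move=> vR; rewrite mxE [X in - X]mxE kexp_t // opprD opprK !mxE.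
rewrite /qidx /tidx eq_rshift (_ : (inord _ == ord0) = false) ?mulr0 ?oppr0 ?add0r //.
by apply/eqP => /(congr1 val); rewrite /= inordK ?ltnS ?index_mem.
Qed.

Lemma root_coef_neq0 b : b \in roots D ->
  exists k, Num.floor (dot b (coroot (simple k))) != 0.
Proof.
move=> bR; apply/existsP; apply: contraLR (root_neq0 bR) => /existsPn b0.
rewrite negbK; apply/eqP/(@dot_simple_eq0 _ _ D) => k.
have := b0 k; rewrite negbK => /eqP f0.
by rewrite -[LHS]floorK ?(roots_int (simple_root D k) bR) // f0.
Qed.

Lemma nuR_nu a : a \in roots D -> nu a \in nuR D.
Proof. by move=> aR; rewrite mem_undup map_f. Qed.

(** If the numerator involves t_v, then z = 2 (rho_v^vee, b) is at least 2 or at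
    most -2 according to the sign of b = w^-1(e.1), and the order is half of
    min(2 + z, 0) - min(z, 0). *)
Lemma tord_kappa_faff v e : v \in nuR D -> e.1 \in roots D ->
  tord v (kappaX w (faff F D m e)) =
  Some ((nu e.1 == v) && ~~ pos (w^T *m e.1))%:R.
Proof.
move=> vR eR; have tA := aut_tr wA; set b := w^T *m e.1.
have bR : b \in roots D by exact: (aut_root tA eR).
have nub : nu b = nu e.1 by rewrite (nu_isom (proj1 tA)).
have [k bk] := root_coef_neq0 bR.
have u0 : uexp e != 0.
  by apply: contra bk => /eqP /rowP /(_ (Xidx D k)); rewrite uexp_X mxE => /eqP;
     rewrite oppr_eq0.
have tu0 : texp (nu e.1) + uexp e != 0.
  apply: contra bk => /eqP /rowP /(_ (Xidx D k)); rewrite mxE texp_X add0r uexp_X mxE.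
  by move=> /eqP; rewrite oppr_eq0.
rewrite kappaX_faff ?inP_root // (tordM (tord_mon1 F v tu0) (tordV (tord_mon1 F v u0))).
rewrite mxE uexp_t // texp_t ?nuR_nu // -/b; congr Some.
have [zE ge gle] : [/\ (Num.floor (height D v b))%:~R = height D v b,
    pos b -> (nu e.1 == v)%:R * 2 <= height D v b &
    ~~ pos b -> (nu e.1 == v)%:R * 2 <= - height D v b].
  split; first by rewrite floorK // height_int // inP_root.
    by rewrite -nub; exact: height_ge.
  by move=> npb; rewrite -heightN -nub -nuN height_ge ?rootN ?posN.
set z := Num.floor (height D v b) in zE *.
move: ge gle; rewrite -zE; case: eqP => _ /=.
  rewrite mul1r -[2 : R]/(2%:~R) -rmorphN !ler_int; case: (pos b) => ge gle /=.
    have z2 := ge isT; have -> : Num.min (2 + z) 0 = 0 by lia.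
    by have -> : Num.min z 0 = 0 by lia; rewrite subrr.
  have z2 := gle isT; have -> : Num.min (2 + z) 0 = 2 + z by lia.
  have -> : Num.min z 0 = z by lia.
  by rewrite intrD; lra.
by rewrite add0r => _ _; rewrite subrr.
Qed.

(** The numerator t - 1 has order 0; the denominator 1 - u is u (u^-1 - 1), for a
    monomial u of order z / 2. *)
Lemma tord_kappa_gaff v e : v \in nuR D -> e.1 \in roots D ->
  tord v (kappaX w (gaff F D m e)) =
  Some ((Num.max 0 (- Num.floor (height D v (w^T *m e.1))))%:~R / 2).
Proof.
move=> vR eR; have tA := aut_tr wA; set b := w^T *m e.1.
have bR : b \in roots D by exact: (aut_root tA eR).
have [k bk] := root_coef_neq0 bR.
have u0 : - uexp e != 0.
  by apply: contra bk; rewrite oppr_eq0 => /eqP /rowP /(_ (Xidx D k));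
     rewrite uexp_X mxE => /eqP; rewrite oppr_eq0.
have t0 : texp (nu e.1) != 0.
  apply/eqP => /rowP /(_ (tidx D (nu e.1))).
  by rewrite texp_t ?nuR_nu // eqxx mxE.
rewrite kappaX_gaff ?inP_root //.
have -> : 1 - mon (uexp e) = mon (uexp e) * (mon (- uexp e) - 1).
  by rewrite mulrBr -monD subrr mon0 mulr1.
rewrite (tordM (tord_mon1 F v t0) (tordV (tordM (tord_mon _ v (uexp e)) (tord_mon1 F v u0)))).
rewrite texp_t ?nuR_nu // [(- uexp e) _ _]mxE uexp_t // -/b; congr Some; set z := Num.floor _.
have -> : Num.min (if nu e.1 == v then 2 else 0) 0 = 0 :> int by case: ifP.
have -> : Num.max 0 (- z) = - z - Num.min (- z) 0 by lia.
by rewrite intrB rmorphN /= mul0r; lra.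
Qed.

Lemma tord_kappa_prod v (I : Type) (r : seq I) (E : I -> affv) : v \in nuR D ->
  (forall i, (E i).1 \in roots D) ->
  tord v (kappaX w (\prod_(i <- r) faff F D m (E i))) =
  Some (\sum_(i <- r) ((nu (E i).1 == v) && ~~ pos (w^T *m (E i).1)))%N%:R.
Proof.
move=> vR ER; elim: r => [|i r IH].
  by rewrite !big_nil -[kappaX w 1]/(kmorph 1) rmorph1 -(mon0 F D) tord_mon mxE mul0r.
rewrite !big_cons -[kappaX _ _]/(kmorph _) rmorphM natrD.
exact: tordM (tord_kappa_faff vR (ER i)) IH.
Qed.

Lemma tord_qrho v b : v \in nuR D ->
  tord v (qrho F D b)^-1 = Some (- (Num.floor (height D v b))%:~R / 2).
Proof. by move=> vR; rewrite qrho_mon (tordV (tord_mon _ _ _)) rexp_t // mulNr. Qed.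

End Morphism.
End Kappa.

(** * Products of difference-reflection operators *)

Section Operators.
Context (F : fieldType) {R : realType} {n : nat} (D : rootData R n) (m : nat).
Local Notation N := (nvars D).
Local Notation poly := {mpoly F[N]}.
Local Notation ratfun := (ratfun F D).
Local Notation tofrac := (@FracField.tofrac {mpoly F[nvars D]}).
Local Notation gen := (@Defs.gen F R n D).
Local Notation simple := (simple D).
Implicit Types (a b : 'cV[R]_n) (w u : 'M[R]_n) (v : R) (g h : ratfun).

Lemma substX_id (y : 'I_n -> ratfun) g : (forall i, y i = gen (Xidx D i)) ->
  substX y g = g.
Proof.
move=> yE; have ev p : evalX y p = tofrac p.
  rewrite /evalX [in RHS](mpolyE p) rmorph_sum; apply: eq_bigr => mm _.
  rewrite -mul_mpolyC rmorphM /=; congr (_ * _).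
  rewrite mpolyXE_id rmorph_prod; apply: eq_bigr => i _.
  rewrite rmorphXn /=; congr (_ ^+ _); rewrite /subst_var.
  by case: (split_ordP i) => k -> //; rewrite yE.
rewrite [RHS]ratfunE -!ev; exact: erefl.
Qed.

Lemma X_fweight i : X F D (fweight D i) = gen (Xidx D i).
Proof.
rewrite /X (bigD1 i) //= dot_fweight eqxx floor1 expr1z big1 ?mulr1 // => k ki.
by rewrite dot_fweight (negbTE ki) floor0 expr0z.
Qed.

Lemma actW1 g : actW 1%:M g = g.
Proof. by apply: substX_id => i; rewrite mul1mx X_fweight. Qed.

Lemma actG0 g : actG m 0 g = g.
Proof.
apply: substX_id => i.
by rewrite dot0l /qpow mulr0 floor0 expr0z mul1r X_fweight.
Qed.

Lemma dmul_dfun g h a u : dmul m (dfun g) (dterm h a u) = dterm (g * h) a u.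
Proof.
rewrite /dmul /dfun /dterm; have [->|g0] := eqVneq g 0.
  by rewrite freegU0 dom0 big_nil mul0r freegU0.
have [->|h0] := eqVneq h 0.
  by rewrite freegU0 dom0 mulr0 freegU0 big1 // => x _; rewrite big_nil.
rewrite (domU _ g0) (domU _ h0) !big_seq1 !coeffU !eqxx !mulr1 /=.
by rewrite actG0 actW1 add0r !mul1mx.
Qed.

Lemma big_dmul (I : Type) (r : seq I) (E : I -> ratfun) :
  \big[dmul m/done1 F D]_(k <- r) dfun (E k) = dfun (\prod_(k <- r) E k).
Proof.
elim: r => [|k r IH]; first by rewrite !big_nil.
by rewrite !big_cons IH dmul_dfun.
Qed.

Lemma sord_dterm v w g a u : sord v w (kappa (dterm g a u)) =
  tord v (kappaX w g * (qrho F D (invmx w *m a))^-1).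
Proof. by rewrite sord_kappa kappa_term /dterm coeffU eqxx mulr1. Qed.

(** By sord_prod, the order in t_v at w of the product of the f_(E i). *)
Definition count_neg v w (I : Type) (r : seq I) (E : I -> 'cV[R]_n) : nat :=
  \sum_(i <- r) ((nu (E i) == v) && ~~ pos D (w^T *m E i)).

Lemma sord_prod v w (I : Type) (r : seq I) (E : I -> affv) : v \in nuR D -> aut D w ->
  (forall i, (E i).1 \in roots D) ->
  sord v w (kappa (\big[dmul m/done1 F D]_(k <- r) dfun (faff F D m (E k)))) =
  Some (count_neg v w r (fst \o E))%:R.
Proof.
move=> vR wA ER; rewrite big_dmul sord_dterm mulmx0.
rewrite (tordM (tord_kappa_prod F m wA r vR ER) (tord_qrho F 0 vR)).
have -> : height D v 0 = 0 by rewrite /height big1 // => a _; rewrite dot0r.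
by rewrite floor0 oppr0 mul0r addr0.
Qed.

Lemma sord_gprod v w (I : Type) (r : seq I) (E : I -> affv) (e : affv) (c : int) u :
  v \in nuR D -> aut D w -> (forall i, (E i).1 \in roots D) -> e.1 \in roots D ->
  let z := Num.floor (height D v (w^T *m e.1)) in
  sord v w (kappa (dterm (gaff F D m e * \prod_(k <- r) faff F D m (E k))
                         (c%:~R *: e.1) u)) =
  Some ((Num.max 0 (- z))%:~R / 2 + (count_neg v w r (fst \o E))%:R
        - (c * z)%:~R / 2).
Proof.
move=> vR wA ER eR z; have tA := aut_tr wA.
have bR : w^T *m e.1 \in roots D by exact: aut_root.
rewrite sord_dterm -[kappaX w _]/(kmorph F wA _) rmorphM (isom_inv (proj1 wA)) -scalemxAr.
rewrite (tordM (tordM (tord_kappa_gaff F m wA vR eR) (tord_kappa_prod F m wA r vR ER))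
               (tord_qrho F _ vR)).
rewrite (_ : Num.floor (height D v (_ *: _)) = c * z) ?mulNr //.
have -> : height D v (c%:~R *: (w^T *m e.1)) = c%:~R * height D v (w^T *m e.1).
  by rewrite !heightE dotZr mulrCA.
by rewrite floorZ_int ?height_int ?inP_root.
Qed.

Lemma count_negE v w (I : Type) (r : seq I) (E : I -> 'cV[R]_n) :
  (count_neg v w r E)%:R = \sum_(i <- r) (nu (E i) == v)%:R * chi D (w^T *m E i) :> R.
Proof.
rewrite natr_sum; apply: eq_bigr => i _; rewrite /chi.
by case: eqP; case: (pos D _); rewrite ?mulr1 ?mulr0 ?mul0r.
Qed.

(** The inequality passes from R, where the roots live, to the rational orders
    through the integers. *)
Lemma half_ineq (A B : nat) (z c : int) (H : R) : H = z%:~R ->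
  2 * A%:R <= Num.max 0 (- H) - c%:~R * H + 2 * B%:R ->
  A%:R <= (Num.max 0 (- z))%:~R / 2 + B%:R - (c * z)%:~R / 2 :> rat.
Proof.
move=> -> h; have : 2 * A%:Z <= Num.max 0 (- z) - c * z + 2 * B%:Z.
  rewrite -(ler_int R) !(rmorphD, rmorphB, rmorphM) /=.
  suff -> : (Num.max 0 (- z))%:~R = Num.max 0 (- z%:~R) :> R.
    by move: h; rewrite -!pmulrn; lra.
  by rewrite !maxEle -rmorphN -[0 : R]/(0%:~R) ler_int; case: ifP.
rewrite -(ler_int rat) !(rmorphD, rmorphB, rmorphM) /=; lra.
Qed.

Lemma count_aroot v w j i (c : int) (e := aroot D j i)
    (z := Num.floor (height D v (w^T *m e.1))) :
  v \in nuR D -> aut D w -> (0 < i)%N -> pos D e.1 -> c%:~R = e.2 / nu e.1 ->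
  (count_neg v w (index_iota 1 i.+1) (fun k => (aroot D j k).1))%:R <=
  (Num.max 0 (- z))%:~R / 2 +
  (count_neg v w (index_iota 1 i) (fun k => refl e.1 *m (aroot D j k).1))%:R
  - (c * z)%:~R / 2 :> rat.
Proof.
move=> vR wA i0 pe cE; have [eR _] := affroot_aroot D j i.
apply: (@half_ineq _ _ z c (height D v (w^T *m e.1))).
  by rewrite /z floorK // height_int // inP_root // aut_root //; apply: aut_tr.
rewrite !count_negE cE.
have eV := refl_isometry (root_neq0 eR).
under [X in _ <= _ + 2 * X]eq_bigr => k _ do rewrite (nu_isom eV).
exact: aroot_count.
Qed.

End Operators.

(** * Words in the finite Weyl group *)

Section FiniteWords.
Context {R : realType} {n : nat} (D : rootData R n).
Local Notation simple := (simple D).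
Local Notation fref i := (fun x : 'cV[R]_n => refl (simple i) *m x).

Lemma wrootE (j : nat -> 'I_n) k :
  wroot D j k = act (fun i => fref i) [seq j i | i <- index_iota 1 k] (simple (j k)).
Proof. exact: big_act. Qed.

Lemma wroot_root (j : nat -> 'I_n) k : wroot D j k \in roots D.
Proof.
rewrite wrootE; have [w wA ->] := act_fref_aut D [seq j i | i <- index_iota 1 k].
exact: aut_root wA (simple_root D _).
Qed.

Lemma aroot_lift (j : nat -> 'I_n) k :
  aroot D (fun i => fintype.lift ord0 (j i)) k = (wroot D j k, 0).
Proof.
have sE i x : arefl (asimple D (fintype.lift ord0 i)) (x, 0) = (fref i x, 0).
  by rewrite arefl_aff /afun /asimple liftK /= oppr0 scale0r dot0l addr0.
rewrite arootE wrootE /asimple liftK; elim: (index_iota 1 k) => //= i r IH.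
by rewrite IH sE.
Qed.

Lemma index_iota_shift s k : index_iota s.+1 (k + s) = [seq (i + s)%N | i <- index_iota 1 k].
Proof.
rewrite /index_iota (_ : (k + s - s.+1 = k - 1)%N); last by lia.
by rewrite -addn1 iotaDl; apply: eq_map => i; rewrite addnC.
Qed.

(** The first s letters act on all later roots by the same element of W, which can
    be absorbed in w. *)
Lemma wroot_shift (j : nat -> 'I_n) s k : (0 < k)%N ->
  wroot D j (k + s) = (\big[mulmx/1%:M]_(1 <= i < s.+1) refl (simple (j i))) *m
                      wroot D (fun i => j (i + s)%N) k.
Proof.
move=> k0; rewrite !wrootE big_act -act_cat; congr (act _ _ _).
have -> : [seq j (i + s)%N | i <- index_iota 1 k] = map j (index_iota s.+1 (k + s)).
  by rewrite index_iota_shift -map_comp.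
rewrite -map_cat; congr map.
rewrite /index_iota (_ : (k + s - 1 = (s.+1 - 1) + (k + s - s.+1))%N); last by lia.
by rewrite iotaD; congr (_ ++ iota _ _); lia.
Qed.

Lemma wreduced_wroot_pos (j : nat -> 'I_n) l s k : wreduced D j l ->
  (0 < k)%N -> (k + s <= l)%N -> pos D (wroot D (fun i => j (i + s)%N) k).
Proof.
move=> red k0 kl; have sk : (s < k + s)%N by lia.
have := wreduced_pos red (ltn0Sn s) (_ : (s < k + s <= l)%N); rewrite sk kl => /(_ isT).
by rewrite wrootE index_iota_shift -map_comp.
Qed.

Lemma count_neg_eq v w r (E E' : nat -> 'cV[R]_n) : {in r, E =1 E'} ->
  count_neg D v w (rev r) E = count_neg D v w r E'.
Proof.
move=> EE; rewrite /count_neg (perm_big r) ?perm_rev //.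
by apply: eq_big_seq => k kr; rewrite EE.
Qed.

Lemma count_neg_shift v w x s b (E E' : nat -> 'cV[R]_n) : aut D x ->
  (forall k, (0 < k)%N -> E (k + s)%N = x *m E' k) ->
  count_neg D v w (rev (index_iota s.+1 (b + s))) E =
  count_neg D v (x^T *m w) (index_iota 1 b) E'.
Proof.
move=> [xV _] EE; rewrite (@count_neg_eq _ _ _ _ E) // /count_neg index_iota_shift big_map.
apply: eq_big_nat => k /andP [k1 _]; rewrite EE // (nu_isom xV).
by rewrite trmx_mul trmxK mulmxA.
Qed.

End FiniteWords.

Theorem lemma5p3 (F : fieldType) (R : realType) (n : nat) (D : rootData R n)
    (m : nat) (F_char0 : [pchar F] =i pred0) (m_gt0 : (0 < m)%N)
    (m_int : forall a b, inP D a -> inP D b -> m%:R * dot a b \is a Num.int) :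
  (forall (u : 'M[R]_n) (j : nat -> 'I_n) (l r p : nat),
     inW D u -> u = wword D j l -> wreduced D j l ->
     (1 <= r)%N -> (r <= p)%N -> (p <= l)%N ->
     forall (i : nat) (w : 'M[R]_n) (v : R),
       (r <= i)%N -> (i <= p)%N -> inW D w -> v \in nuR D ->
       let alpha k := wroot D j k in
       let s k := refl (alpha k) in
       let f a := dfun (faff F D m (a, 0)) in
       let g a := dfun (gaff F D m (a, 0)) in
       let ord S := sord v w (kappa S) in
       ole
         (ord (\big[dmul m/done1 F D]_(k <- rev (index_iota r i.+1))
                 f (alpha k)))
         (ord (dmul m (g (alpha i))
                 (\big[dmul m/done1 F D]_(k <- rev (index_iota r i))
                    f (s i *m alpha k)))))
  /\
  (forall (b : 'cV[R]_n) (pi : affv -> affv) (j : nat -> 'I_n.+1) (l : nat),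
     inPplus D b -> inPi D pi ->
     atrans b =1 pi \o aword D j l -> areduced D j l ->
     forall (i : nat) (w : 'M[R]_n) (v : R),
       (1 <= i)%N -> (i <= l)%N -> inW D w -> v \in nuR D ->
       let alpha k := aroot D j k in
       let f e := dfun (faff F D m e) in
       let g e := dfun (gaff F D m e) in
       let sigma k := saff F D (alpha k) in
       let ord S := sord v w (kappa S) in
       ole
         (ord (\big[dmul m/done1 F D]_(k <- rev (index_iota 1 i.+1))
                 f (alpha k)))
         (ord (dmul m (dmul m (g (alpha i))
                 (\big[dmul m/done1 F D]_(k <- rev (index_iota 1 i))
                    f (arefl (alpha i) (alpha k))))
                 (sigma i)))).
Proof.
split.
  move=> u j l r p _ _ red r1 rp pl i w v ri ip /inW_aut wA vR; cbv zeta.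
  have aR k : wroot D j k \in roots D by exact: wroot_root.
  rewrite (@sord_prod F R n D m v w _ _ (fun k => (wroot D j k, 0))) // big_dmul dmul_dfun.
  rewrite -(scale0r (wroot D j i, 0 : R).1) -[X in X *: _]/(0%:~R).
  rewrite (@sord_gprod F R n D m v w _ _ (fun k => (refl (wroot D j i) *m wroot D j k, 0))
     (wroot D j i, 0) 0 1%:M vR wA (fun k => roots_refl (aR i) (aR k)) (aR i)).
  (* Dropping the first s letters turns the range r, ..., i into 1, ..., k. *)
  set s := r.-1; set k := (i - s)%N.
  have rE : r = s.+1 by rewrite prednK.
  have iE : i = (k + s)%N by rewrite subnK // ltnW // -rE.
  have k0 : (0 < k)%N by rewrite subn_gt0 -rE.
  have kl : (k + s <= l)%N by rewrite -iE (leq_trans ip pl).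
  have [x xA xE] := act_fref_aut D [seq j k | k <- index_iota 1 s.+1].
  have [xV _] := xA.
  pose jj i := fintype.lift ord0 (j (i + s)%N).
  pose E k := (aroot D jj k).1.
  have shift k' : (0 < k')%N -> wroot D j (k' + s) = x *m E k'.
    by move=> k'0; rewrite wroot_shift // big_act xE /E aroot_lift.
  have pe : pos D (E k) by rewrite /E aroot_lift; exact: wreduced_wroot_pos kl.
  have cE : 0%:~R = (aroot D jj k).2 / nu (E k) by rewrite aroot_lift mul0r.
  have := count_aroot vR (autM (aut_tr xA) wA) k0 pe cE.
  rewrite -/(E k) trmx_mul trmxK -mulmxA -shift // -iE => le.
  have c1 : count_neg D v w (rev (index_iota r i.+1)) (fun k => wroot D j k) =
      count_neg D v (x^T *m w) (index_iota 1 k.+1) E.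
    by rewrite rE iE -addSn; exact: count_neg_shift xA shift.
  have c2 : count_neg D v w (rev (index_iota r i))
        (fun k => refl (wroot D j i) *m wroot D j k) =
      count_neg D v (x^T *m w) (index_iota 1 k) (fun k' => refl (E k) *m E k').
    rewrite rE iE; apply: count_neg_shift xA _ => k' k'0.
    by rewrite !shift // refl_isom.
  by rewrite /ole /comp /= c1 c2.
move=> b pi j l bP piP bE red i w v i1 il /inW_aut wA vR; cbv zeta.
have aR k : (aroot D j k).1 \in roots D by case: (affroot_aroot D j k).
have pe : pos D (aroot D j i).1 by apply: (aroot_pos bP piP bE red); rewrite i1.
have [eR /intrP [c cE]] := affroot_aroot D j i.
(* The affine reflection is Gamma_(c alpha) s_alpha, with c as in cE. *)
rewrite sord_prod // big_dmul dmul_dfun /saff dmul_dfun mulr1 cE.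
rewrite (@sord_gprod F R n D m v w _ _ (fun k => arefl (aroot D j i) (aroot D j k))
  (aroot D j i)) //; last by move=> k; rewrite arefl_aff; exact: roots_refl.
have := count_aroot vR wA i1 pe (esym cE).
rewrite /ole (@count_neg_eq _ _ _ _ _ _ _ (fun k => (aroot D j k).1)) //.
rewrite (@count_neg_eq _ _ _ _ _ _ _ (fun k => refl (aroot D j i).1 *m (aroot D j k).1)) //.
by move=> k _; rewrite /comp arefl_aff.
Qed.
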